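(* Let $M>0$, $\delta\in(0,1)$, $k\ge1$, and let $h$ be a function from $[-1,1]^k$ to the set of $n\times n$ interaction matrices that satisfies $\|h(\vec\beta)-h(\vec\beta')\|_2\le L\|\vec\beta-\vec\beta'\|_\infty$ for all $\vec\beta,\vec\beta'\in[-1,1]^k$, for some $L>0$. Define $\mathcal{J}=\{J=h(\vec\beta):\vec\beta\in[-1,1]^k,\ \|J\|_\infty\le M\}$. Let $x\sim\Pr_{J^*}$ be a single sample with $J^*\in\mathcal{J}$, and let $\hat J=\hat J(x)$ be a minimizer of $\varphi(x;J)$ over $J\in\mathcal{J}$. Then with probability at least $1-\delta$, $$\|\hat J-J^*\|_F\le C(M)\sqrt{k(\log n+\log L)+\log(1/\delta)},$$ where $C(M)$ is a (singly) exponential function of $M$.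
   Context: An interaction matrix is a real symmetric $n\times n$ matrix $J$ with zero diagonal. The Ising model $\Pr_J$ is the distribution on $\{\pm1\}^n$ with $\Pr_J[x]\propto\exp(x^\top Jx/2)$. For matrices, $\|J\|_\infty=\max_i\sum_j|J_{ij}|$, $\|\cdot\|_2$ is the spectral norm and $\|\cdot\|_F$ the Frobenius norm; for vectors $\|\cdot\|_\infty$ is the sup norm. The negative log pseudo-likelihood is $\varphi(x;J)=-\sum_{i=1}^n\log\Pr_J[x_i\mid x_{-i}]$, where $x_{-i}$ denotes all coordinates of $x$ except the $i$-th.
   Formalization: The quantity k(log n + log L) + log(1/δ) under the square root is replaced by its maximum with log 2, because the stated bound is false or undefined when that quantity is near zero or negative (possible only if nL < 2); nothing changes when nL ≥ 2. *)

(* Defs.v *)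
From HB Require Import structures.
From mathcomp Require Import all_boot all_order all_algebra.
From mathcomp Require Import all_classical all_reals all_analysis.

Set Implicit Arguments.
Unset Strict Implicit.
Unset Printing Implicit Defensive.

Import Order.TTheory GRing.Theory Num.Theory.
Import numFieldNormedType.Exports.

Local Open Scope classical_set_scope.
Local Open Scope ring_scope.

Section Norms.
Context {R : realType} {n : nat}.

(* The library norm `|A| on matrices is the entrywise maximum, none of the
   three matrix norms below.  On the row vectors 'rV[R]_k it is the sup norm. *)

Definition infty_norm (A : 'M[R]_n) : R :=
  \big[Num.max/0]_(i < n) \sum_(j < n) `|A i j|.

Definition frobenius_norm (A : 'M[R]_n) : R :=
  Num.sqrt (\sum_(i < n) \sum_(j < n) A i j ^+ 2).

Definition euclidean_norm (v : 'cV[R]_n) : R :=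
  Num.sqrt (\sum_(i < n) v i 0 ^+ 2).

Definition spectral_norm (A : 'M[R]_n) : R :=
  sup [set euclidean_norm (A *m v) | v in [set v | euclidean_norm v <= 1]].

End Norms.

Section Ising.
Context {R : realType} {n : nat}.

Definition interaction_matrix (J : 'M[R]_n) : Prop :=
  J^T = J /\ forall i, J i i = 0.

(* A point of {-1, 1}^n, where true stands for 1 and false for -1. *)
Definition config := {ffun 'I_n -> bool}.

Definition spins (x : config) : 'cV[R]_n :=
  \col_i (if x i then 1 else -1).

Definition ising_weight (J : 'M[R]_n) (x : config) : R :=
  expR (((spins x)^T *m J *m spins x) 0 0 / 2).

Definition ising_pmf (J : 'M[R]_n) (x : config) : R :=
  ising_weight J x / \sum_(y : config) ising_weight J y.

Definition ising_prob (J : 'M[R]_n) (E : {set config}) : R :=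
  \sum_(x in E) ising_pmf J x.

Definition agree_off (i : 'I_n) (x : config) : {set config} :=
  [set y : config | [forall j, (j != i) ==> (y j == x j)]]%SET.

(* Pr_J[x_i | x_{-i}]: the numerator is the probability that y_i = x_i and
   y_{-i} = x_{-i}. *)
Definition ising_cond (J : 'M[R]_n) (i : 'I_n) (x : config) : R :=
  ising_prob J [set y in agree_off i x | y i == x i]%SET
  / ising_prob J (agree_off i x).

Definition neg_log_pl (x : config) (J : 'M[R]_n) : R :=
  - \sum_(i < n) ln (ising_cond J i x).

Definition is_minimizer (f : 'M[R]_n -> R) (S : set 'M[R]_n) (J : 'M[R]_n) :
    Prop :=
  S J /\ forall J', S J' -> f J <= f J'.

End Ising.

Arguments config : clear implicits.

Definition cube {R : realType} (k : nat) : set 'rV[R]_k :=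
  [set b | forall i, -1 <= b 0 i <= 1].
Arguments cube {R} k.

(* h is only meaningful on the cube; its values elsewhere play no role. *)
Definition param_class {R : realType} {n k : nat} (h : 'rV[R]_k -> 'M[R]_n)
    (M : R) : set 'M[R]_n :=
  [set h b | b in cube k] `&` [set J | infty_norm J <= M].

(* Main.v *)
Require Import Defs.
From HB Require Import structures.
From mathcomp Require Import all_boot all_order all_algebra.
From mathcomp Require Import all_classical all_reals all_analysis.
From mathcomp Require Import ring lra.

(** The minimizer can be far from the true matrix [J] only if some other matrix
    of the class has a pseudo-likelihood at least as good as that of [J]. For a
    single competitor [J'], with [A = J' - J], this has probability at most
    exponentially small in the squared Frobenius norm [F] of [A]
    ([pl_separation]). The class is covered by at most [(n * L) ^+ (2 * k)]
    spectral balls of radius [2 / n] ([param_class_net]), on which the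
    pseudo-likelihood varies by a bounded amount ([neg_log_pl_lip]), and a union
    bound over the centres gives the theorem. If [n * L <= 2], the whole class
    has bounded Frobenius diameter and nothing probabilistic is needed.

    The separation estimate is where the dependence between the spins matters.
    Let [s] be the vector of spins and [e] the vector of residuals, spins minus
    their conditional means given the other spins. The negative log
    pseudo-likelihood is a sum of logistic losses, which are strongly convex on
    bounded intervals, so its decrease from [J] to [J'] is at most
    [<A s, e> - 2 c |A s|^2] with [c] exponentially small in [M]. The linear
    term has mean zero, and [|A s|^2] should be of order [F]. To see the latter
    without computing covariances, test [A s] against [A e]: completing squares,
    the decrease is at most the potential
    [<A s, e> - a <A s, A e> + b |A e|^2 - (c / 2) |A s|^2]
    ([neg_log_pl_decrease_le]), in which [<A s, A e>] has mean at least a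
    multiple of [F] and [|A e|^2] has mean at most a multiple of [F].

    All of this is made exponential by one integration by parts: for every
    function [H], the mean of [H e_i] is the mean of
    [q_i s_i (H - H o flip_i)], where [flip_i] reverses the spin [i] and [q_i] is
    its conditional flip probability ([integration_by_parts]). This is
    reversibility of the single-spin dynamics, and it holds at every
    temperature. Applied to the derivative of the moment generating function of
    the potential, it produces a main term of order [- F] and error terms with
    an additional small factor, bounded by [F], [|A s|^2] and [|A e|^2]; the
    last two are absorbed by the quadratic terms of the potential. Since
    [expR (- u) >= 1 - u], a nonpositive derivative at a single point already
    bounds the moment generating function there ([expect_exp_le1]), which yields
    [expect_exp_potential].

    All the constants are powers of [kap = conditioning M], which is
    exponential in [M]. *)

Set Implicit Arguments.
Unset Strict Implicit.
Unset Printing Implicit Defensive.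

Import Order.TTheory GRing.Theory Num.Theory.
Import numFieldNormedType.Exports.

Local Open Scope ring_scope.

(** * Matrix-vector products, quadratic forms and the Schur test *)

Section LinearAlgebra.
Context {R : realType} {n : nat}.
Implicit Types (P : 'M[R]_n) (u v w : 'I_n -> R) (E : 'I_n -> 'I_n -> R).

Definition mulv P u (i : 'I_n) : R := \sum_j P i j * u j.
Definition dot u v : R := \sum_i u i * v i.

Lemma dotC u v : dot u v = dot v u.
Proof. by apply: eq_bigr => i _; rewrite mulrC. Qed.

Lemma dot_sqr u : dot u u = \sum_i u i ^+ 2.
Proof. by apply: eq_bigr => i _; rewrite expr2. Qed.

Lemma mulv_adjoint P u v : P^T = P -> dot u (mulv P v) = dot (mulv P u) v.
Proof.
move=> PT; rewrite /dot /mulv.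
under eq_bigr do rewrite mulr_sumr.
rewrite exchange_big /=; apply: eq_bigr => j _; rewrite mulr_suml.
by apply: eq_bigr => i _; rewrite -{1}PT mxE; ring.
Qed.

Lemma mulv_mulmx P P' u i : mulv (P *m P') u i = mulv P (mulv P' u) i.
Proof.
rewrite /mulv; under eq_bigr do rewrite mxE mulr_suml.
rewrite exchange_big /=; apply: eq_bigr => j _; rewrite mulr_sumr.
by apply: eq_bigr => k _; rewrite mulrA.
Qed.

Lemma dot_mulmx P u v : P^T = P -> dot u (mulv (P *m P) v) = dot (mulv P u) (mulv P v).
Proof.
by move=> PT; rewrite -mulv_adjoint //; apply: eq_bigr => i _; rewrite mulv_mulmx.
Qed.

Lemma mulvB P u v i : mulv P u i - mulv P v i = mulv P (fun k => u k - v k) i.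
Proof. by rewrite /mulv -sumrB; apply: eq_bigr => j _; rewrite mulrBr. Qed.

Lemma form_diff P u v : P^T = P ->
  dot u (mulv P u) - dot v (mulv P v) =
  dot (fun k => u k - v k) (mulv P u) + dot (fun k => u k - v k) (mulv P v).
Proof.
move=> PT; have dotBl w : dot (fun k => u k - v k) w = dot u w - dot v w.
  by rewrite /dot -sumrB; apply: eq_bigr => k _; rewrite mulrBl.
by rewrite !dotBl [dot v (mulv P u)]mulv_adjoint // [dot (mulv P v) u]dotC addrA subrK.
Qed.

Lemma col_sum_sym P j : P^T = P -> \sum_i `|P i j| = \sum_i `|P j i|.
Proof. by move=> PT; apply: eq_bigr => i _; rewrite -{1}PT mxE. Qed.

Lemma sum_mul_le w u (c d : R) : (forall i, 0 <= w i) -> (forall i, u i <= c) ->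
  0 <= c -> \sum_i w i <= d -> \sum_i w i * u i <= d * c.
Proof.
move=> w0 uc c0 wd; apply: (@le_trans _ _ (\sum_i w i * c)).
  by apply: ler_sum => i _; apply: ler_wpM2l.
by rewrite -mulr_suml; apply: ler_wpM2r.
Qed.

(** Expand the nonnegative sum of the [w i * (v i - t) ^+ 2] at the value
    of [t] that minimizes it when the weights have total mass [kap]. *)
Lemma weighted_Cauchy_Schwarz w v (kap : R) :
  0 < kap -> (forall i, 0 <= w i) -> \sum_i w i <= kap ->
  (\sum_i w i * v i) ^+ 2 <= kap * \sum_i w i * v i ^+ 2.
Proof.
move=> k0 w0 wk; set S := \sum_i w i * v i; set t := S / kap.
have : 0 <= \sum_i w i * (v i - t) ^+ 2.
  by apply: sumr_ge0 => i _; rewrite mulr_ge0 ?sqr_ge0.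
have -> : \sum_i w i * (v i - t) ^+ 2 =
    \sum_i w i * v i ^+ 2 - 2 * t * S + t ^+ 2 * \sum_i w i.
  rewrite /S !mulr_sumr -sumrB -big_split /=.
  by apply: eq_bigr => i _; ring.
set V := \sum_i w i * v i ^+ 2; set W := \sum_i w i in wk *.
have tk : t * kap = S by rewrite /t mulfVK // gt_eqF.
have tW : t ^+ 2 * W <= t * S by rewrite -tk mulrA -expr2 ler_wpM2l ?sqr_ge0.
move=> h; have VtS : t * S <= V by lra.
have -> : S ^+ 2 = kap * (t * S) by rewrite expr2 -{1}tk; ring.
by rewrite ler_wpM2l // ltW.
Qed.

(** Cauchy-Schwarz with the weights of each row, then summation along the
    columns. *)
Lemma Schur_test E v (kap : R) :
  0 < kap -> (forall i j, 0 <= E i j) ->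
  (forall i, \sum_j E i j <= kap) -> (forall j, \sum_i E i j <= kap) ->
  \sum_i (\sum_j E i j * v j) ^+ 2 <= kap ^+ 2 * \sum_j v j ^+ 2.
Proof.
move=> k0 E0 Er Ec.
apply: (@le_trans _ _ (\sum_i kap * \sum_j E i j * v j ^+ 2)).
  by apply: ler_sum => i _; apply: weighted_Cauchy_Schwarz.
rewrite -mulr_sumr expr2 -mulrA ler_wpM2l ?(ltW k0) //.
rewrite exchange_big mulr_sumr /=. apply: ler_sum => j _.
by rewrite -mulr_suml ler_wpM2r ?sqr_ge0.
Qed.

Lemma mulv_norm_le P v (kap : R) : 0 < kap -> P^T = P ->
  (forall i, \sum_j `|P i j| <= kap) ->
  \sum_i mulv P v i ^+ 2 <= kap ^+ 2 * \sum_j v j ^+ 2.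
Proof.
move=> k0 PT Pr; rewrite -(eq_bigr _ (fun j _ => real_normK (num_real (v j)))).
apply: le_trans (@Schur_test (fun i j => `|P i j|) (fun j => `|v j|) _ k0 _ _ _).
- apply: ler_sum => i _; rewrite -[leLHS]real_normK ?num_real //.
  rewrite lerXn2r ?nnegrE //; first by apply: sumr_ge0 => j _; rewrite mulr_ge0.
  by apply: le_trans (ler_norm_sum _ _ _) _; apply: ler_sum => j _; rewrite normrM.
- by [].
- by [].
- by move=> j; rewrite col_sum_sym.
Qed.

Lemma mulv_sup_le P v (kap c : R) i : 0 <= c ->
  (forall i, \sum_j `|P i j| <= kap) -> (forall j, `|v j| <= c) ->
  `|mulv P v i| <= kap * c.
Proof.
move=> c0 Pr vc; apply: le_trans (ler_norm_sum _ _ _) _.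
under eq_bigr do rewrite normrM.
exact: sum_mul_le.
Qed.

(** A quadratic form changes by its two first-order terms, which are controlled
    by the vectors [mulv P u] and [mulv P v] themselves, and one second-order
    term. *)
Lemma form_increment P u v u' v' w : P^T = P ->
  (forall k, `|u k - u' k| <= w k) -> (forall k, `|v k - v' k| <= w k) ->
  `|dot u (mulv P v) - dot u' (mulv P v')| <=
    \sum_k w k * `|mulv P v k| + \sum_k w k * `|mulv P u k| +
    \sum_k w k * \sum_l `|P k l| * w l.
Proof.
move=> PT uw vw.
have w0 k : 0 <= w k by apply: le_trans (uw k).
have -> : dot u (mulv P v) - dot u' (mulv P v') =
    \sum_k (u k - u' k) * mulv P v k + \sum_k (v k - v' k) * mulv P u k
    - \sum_k (u k - u' k) * mulv P (fun l => v l - v' l) k.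
  have -> : \sum_k (v k - v' k) * mulv P u k =
      dot u (mulv P (fun l => v l - v' l)) by rewrite mulv_adjoint // dotC.
  rewrite /dot -sumrB -big_split -sumrB /=; apply: eq_bigr => k _.
  by rewrite -!mulvB; ring.
apply: le_trans (ler_normB _ _) _; apply: lerD.
  apply: le_trans (ler_normD _ _) _; apply: lerD;
    apply: le_trans (ler_norm_sum _ _ _) _; apply: ler_sum => k _;
    by rewrite normrM ler_wpM2r.
apply: le_trans (ler_norm_sum _ _ _) _; apply: ler_sum => k _.
rewrite normrM ler_pM //; apply: le_trans (ler_norm_sum _ _ _) _.
by apply: ler_sum => l _; rewrite normrM ler_wpM2l.
Qed.

Definition row_norm P (i : 'I_n) : R := Num.sqrt (\sum_j P i j ^+ 2).

Lemma row_norm_ge0 P i : 0 <= row_norm P i.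
Proof. exact: sqrtr_ge0. Qed.

Lemma sqr_row_norm P i : row_norm P i ^+ 2 = \sum_j P i j ^+ 2.
Proof. by rewrite sqr_sqrtr // sumr_ge0 // => j _; rewrite sqr_ge0. Qed.

Lemma entry_le_row_norm P i j : `|P i j| <= row_norm P i.
Proof.
rewrite -sqrtr_sqr ler_wsqrtr // (bigD1 j) //= lerDl.
by rewrite sumr_ge0 // => k _; rewrite sqr_ge0.
Qed.

Lemma row_norm_le P i (kap : R) : \sum_j `|P i j| <= kap -> row_norm P i <= kap.
Proof.
move=> Pk; have k0 : 0 <= kap by apply: le_trans Pk; apply: sumr_ge0.
rewrite -[kap]ger0_norm // -sqrtr_sqr ler_wsqrtr //.
apply: (@le_trans _ _ ((\sum_j `|P i j|) ^+ 2)); last first.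
  by rewrite lerXn2r ?nnegrE ?sumr_ge0.
rewrite [leRHS]expr2 mulr_suml; apply: ler_sum => j _.
rewrite -[leLHS]real_normK ?num_real // expr2 ler_wpM2l //.
by rewrite (bigD1 j) //= lerDl sumr_ge0.
Qed.

(** The two bounds on an entry of the square of a symmetric matrix serve
    different purposes: the first one, linear in a single row norm, is squared
    before it is summed; the second one is summed directly against a matrix with
    bounded rows and columns, and both of its terms then give a multiple of the
    squared Frobenius norm. *)
Lemma sqrmx_entry_le P k l (kap : R) : P^T = P ->
  (forall i, \sum_j `|P i j| <= kap) ->
  `|(P *m P) k l| <= kap * row_norm P k.
Proof.
move=> PT Pk; rewrite mxE; apply: le_trans (ler_norm_sum _ _ _) _.
under eq_bigr do rewrite normrM mulrC.
apply: sum_mul_le => //; [by move=> i; apply: entry_le_row_norm|exact: row_norm_ge0|].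
by rewrite col_sum_sym.
Qed.

Lemma sqrmx_entry_le_mean P k l : P^T = P ->
  `|(P *m P) k l| <= (row_norm P k ^+ 2 + row_norm P l ^+ 2) / 2.
Proof.
move=> PT; rewrite !sqr_row_norm mxE; apply: le_trans (ler_norm_sum _ _ _) _.
rewrite -big_split mulr_suml /=; apply: ler_sum => j _.
have -> : P l j = P j l by rewrite -{1}PT mxE.
rewrite normrM -(real_normK (num_real (P k j))) -(real_normK (num_real (P j l))).
have := sqr_ge0 (`|P k j| - `|P j l|); rewrite sqrrB; lra.
Qed.

Lemma sqrmx_diag P i : P^T = P -> (P *m P) i i = row_norm P i ^+ 2.
Proof.
move=> PT; rewrite sqr_row_norm mxE; apply: eq_bigr => j _.
by rewrite -{2}PT mxE expr2.
Qed.

End LinearAlgebra.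

(** * Strong convexity of the logistic loss *)

Section SoftPlus.
Context {R : realType}.
Implicit Types (x y z a b M : R).

(** A second-order Taylor bound, with a remainder that is positive on both sides
    of [0]. With [t = - y > 0] and after multiplication by [expR t] it becomes
    [(1 - t) * expR t <= 1 - t ^+ 2 / 4]. *)
Lemma expR_ge_quadratic y : 1 + y + y ^+ 2 / 4 * expR (- `|y|) <= expR y.
Proof.
have [y0|y0] := leP 0 y.
  rewrite ger0_norm //.
  have h : 1 + y + y ^+ 2 / 4 <= expR y.
    have -> : expR y = expR (y / 2) ^+ 2 by rewrite expr2 -expRD; congr expR; field.
    have : 1 + y / 2 <= expR (y / 2) := expR_ge1Dx _.
    have := @expR_gt0 R (y / 2); nra.
  apply: le_trans h; rewrite lerD2l -[leRHS]mulr1 ler_wpM2l //.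
    by rewrite divr_ge0 ?sqr_ge0.
  by rewrite expR_le1; lra.
rewrite ltr0_norm // opprK; set t := - y.
have -> : y = - t by rewrite /t; lra.
have t0 : 0 < t by rewrite /t; lra.
rewrite expRN sqrrN; set z := expR t.
have z0 : 0 < z := expR_gt0 t.
suff h : (1 - t) * z <= 1 - t ^+ 2 / 4.
  rewrite -(ler_pM2r z0) mulVf ?gt_eqF //.
  have -> : (1 - t + t ^+ 2 / 4 * z^-1) * z = (1 - t) * z + t ^+ 2 / 4.
    by field; rewrite gt_eqF.
  lra.
have zt : 1 + t <= z := expR_ge1Dx t.
have [t1|t1] := leP 1 t; first by nra.
(* for [t < 1], use [expR t <= (1 - t / 2) ^- 2] *)
have e2 : 1 - t / 2 <= expR (- (t / 2)) by have := expR_ge1Dx (- (t / 2)).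
have ez : expR (- (t / 2)) ^+ 2 * z = 1.
  by rewrite expr2 -expRD -expRD -[RHS]expR0; congr expR; field.
have h2 : (1 - t / 2) ^+ 2 * z <= 1.
  by rewrite -[leRHS]ez ler_wpM2r ?(ltW z0) // lerXn2r ?nnegrE ?expR_ge0 //; lra.
have t4 : 0 <= 1 - t ^+ 2 / 4 by nra.
apply: (@le_trans _ _ ((1 - t ^+ 2 / 4) * ((1 - t / 2) ^+ 2 * z))).
  rewrite mulrA ler_wpM2r ?(ltW z0) //.
  have -> : (1 - t ^+ 2 / 4) * (1 - t / 2) ^+ 2 = 1 - t + t ^+ 3 / 4 * (1 - t / 4).
    by field.
  have : 0 <= t ^+ 3 / 4 * (1 - t / 4).
    by rewrite mulr_ge0 ?divr_ge0 ?exprn_ge0 ?(ltW t0) //; lra.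
  lra.
by rewrite -[leRHS]mulr1 ler_wpM2l.
Qed.

Lemma expR_increment_le (t : R) : `|t| <= 1 / 2 -> `|1 - expR t| <= 2 * `|t|.
Proof.
move=> ht; have h1 := expR_ge1Dx t.
have [t0|t0] := leP 0 t.
  rewrite distrC ger0_norm; last by lra.
  have h2 := expR_ge1Dx (- t); rewrite expRN in h2.
  rewrite ger0_norm // in ht *.
  have := expR_gt0 t; set z := expR t in h1 h2 *; move=> z0.
  have := ler_wpM2l (ltW z0) h2; rewrite divff ?gt_eqF //; nra.
have : expR t <= 1 by rewrite expR_le1 ltW.
move=> h; rewrite ger0_norm; last by lra.
rewrite ltr0_norm //; lra.
Qed.

Lemma norm_scale_le (t m y z : R) :
  0 <= t <= m -> `|y| <= z -> `|t * y| <= m * z.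
Proof. by move=> /andP[t0 tm] yz; rewrite normrM ger0_norm // ler_pM. Qed.

Definition softplus y : R := ln (1 + expR y).

Lemma add1expR_gt0 y : 0 < 1 + expR y.
Proof. by rewrite ltr_wpDl ?expR_gt0. Qed.

Lemma softplus_lip a b : softplus a - softplus b <= `|a - b|.
Proof.
rewrite /softplus lerBlDr -[leRHS](expRK) ler_ln ?posrE ?expR_gt0 ?add1expR_gt0 //.
rewrite expRD lnK ?posrE ?add1expR_gt0 //.
have h : expR a <= expR `|a - b| * expR b.
  by rewrite -expRD ler_expR; have := ler_norm (a - b); lra.
have : 1 <= expR `|a - b| by rewrite -[leLHS]expR0 ler_expR.
rewrite mulrDr mulr1; lra.
Qed.

Lemma sigmoid_lip a b :
  `|(1 + expR a)^-1 - (1 + expR b)^-1| <= `|a - b|.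
Proof.
wlog ab : a b / a <= b.
  move=> H; have [/H//|/ltW/H] := leP a b.
  by rewrite distrC [in leRHS]distrC.
have pa := add1expR_gt0 a; have pb := add1expR_gt0 b.
have eab : expR a <= expR b by rewrite ler_expR.
rewrite ger0_norm ?subr_ge0 ?lef_pV2 ?posrE // ?lerD2l //.
rewrite distrC ger0_norm ?subr_ge0 //.
have -> : (1 + expR a)^-1 - (1 + expR b)^-1 =
   (expR b - expR a) / ((1 + expR a) * (1 + expR b)).
  by field; rewrite !gt_eqF.
rewrite ler_pdivrMr ?mulr_gt0 //.
have h : expR b - expR a <= expR b * (b - a).
  have := @expR_ge1Dx R (a - b); have := expR_gt0 b.
  have -> : expR a = expR b * expR (a - b) by rewrite -expRD; congr expR; field.
  nra.
apply: (le_trans h); rewrite mulrC ler_wpM2l ?subr_ge0 //.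
have := expR_gt0 a; have := expR_gt0 b; nra.
Qed.

Lemma ln_add1_ge z : 0 <= z -> z <= 1 -> z / 2 <= ln (1 + z).
Proof.
move=> z0 z1; have p : 0 < 1 + z by lra.
rewrite -[leLHS]expRK ler_ln ?posrE ?expR_gt0 //.
rewrite -[expR _]invrK -expRN.
have h : 1 - z / 2 <= expR (- (z / 2)) := expR_ge1Dx _.
rewrite invf_ple ?posrE ?expR_gt0 //.
apply: le_trans h; rewrite -(ler_pM2r p) mulVf ?gt_eqF //; nra.
Qed.

(** Two-sided bounds on the logit keep the Bernoulli variance [p * (1 - p)]
    away from [0], and this variance is the second derivative. The proof avoids
    differentiation: with [p] the sigmoid of [y0] and [d = y - y0], the
    difference of the two values minus its linear part is the logarithm of the
    centred moment generating function
    [(1 - p) * expR (- (p * d)) + p * expR ((1 - p) * d)], to which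
    [expR_ge_quadratic] applies term by term. *)
Lemma softplus_strongly_convex M y y0 : 0 < M ->
  `|y| <= 2 * M -> `|y0| <= 2 * M ->
  (1 + expR (- y0))^-1 * (y - y0) + expR (- (8 * M)) / 32 * (y - y0) ^+ 2
  <= softplus y - softplus y0.
Proof.
move=> M0 hy hy0; set d := y - y0; set p := (1 + expR (- y0))^-1.
have dM : `|d| <= 4 * M by apply: le_trans (ler_normB _ _) _; lra.
have e0 := expR_gt0 y0.
have pE : p = expR y0 / (1 + expR y0).
  by rewrite /p expRN; field; rewrite !gt_eqF // add1expR_gt0.
set q := 1 - p.
have qE : q = (1 + expR y0)^-1.
  by rewrite /q pE; field; rewrite gt_eqF // add1expR_gt0.
pose k := expR (- (2 * M)).
have k0 : 0 < k := expR_gt0 _.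
have k1 : k <= 1 by rewrite expR_le1; lra.
have sig_ge x : `|x| <= 2 * M -> k / 2 <= (1 + expR x)^-1.
  move=> hx; have hk : k * expR x <= 1.
    by rewrite -expRD expR_le1; have := ler_norm x; lra.
  have px := add1expR_gt0 x.
  rewrite -(ler_pM2r px) mulVf ?gt_eqF //; lra.
have pk : k / 2 <= p by apply: sig_ge; rewrite normrN.
have qk : k / 2 <= q by rewrite qE; apply: sig_ge.
have pq1 : p + q = 1 by rewrite /q; lra.
have -> : softplus y - softplus y0 = p * d + ln (expR (- (p * d)) * (q + p * expR d)).
  rewrite lnM ?posrE ?expR_gt0 //; last by have := expR_gt0 d; nra.
  rewrite expRK addrA subrr add0r /softplus -ln_div ?posrE ?add1expR_gt0 //.
  congr ln; rewrite qE pE /d expRB; field.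
  by rewrite !gt_eqF // add1expR_gt0.
rewrite lerD2l.
have -> : expR (- (p * d)) * (q + p * expR d) = q * expR (- (p * d)) + p * expR (q * d).
  have -> : q * d = - (p * d) + d by rewrite /q; ring.
  by rewrite (expRD (- (p * d)) d); ring.
pose m := k ^+ 2 / 4.
have k2 : k ^+ 2 = expR (- (4 * M)) by rewrite expr2 -expRD; congr expR; field.
have quad r : 0 <= r -> r <= 1 -> 1 + r * d + m * (r * d) ^+ 2 <= expR (r * d) /\
    1 - r * d + m * (r * d) ^+ 2 <= expR (- (r * d)).
  move=> r0 r1.
  have rd : `|r * d| <= 4 * M.
    by rewrite normrM (ger0_norm r0); have := normr_ge0 d; nra.
  have ek : k ^+ 2 <= expR (- `|r * d|) by rewrite k2 ler_expR; lra.
  have s0 := sqr_ge0 (r * d).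
  split.
    by have := expR_ge_quadratic (r * d); rewrite /m; nra.
  by have := expR_ge_quadratic (- (r * d)); rewrite normrN sqrrN /m; nra.
have p01 : 0 <= p /\ p <= 1 by lra.
have q01 : 0 <= q /\ q <= 1 by lra.
have [_ hp] := quad p p01.1 p01.2; have [hq _] := quad q q01.1 q01.2.
pose z := m * (p * q) * d ^+ 2.
have hz : 1 + z <= q * expR (- (p * d)) + p * expR (q * d).
  have -> : 1 + z = q * (1 - p * d + m * (p * d) ^+ 2) +
                    p * (1 + q * d + m * (q * d) ^+ 2).
    by rewrite /z /q; ring.
  by apply: lerD; apply: ler_wpM2l; [exact: q01.1|exact: hp|exact: p01.1|exact: hq].
have m0 : 0 <= m by rewrite /m divr_ge0 // sqr_ge0.
have d0 := sqr_ge0 d.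
have pq0 : 0 <= p * q by apply: mulr_ge0; [exact: p01.1|exact: q01.1].
have z0 : 0 <= z by rewrite /z mulr_ge0 // mulr_ge0.
have dd : d ^+ 2 <= 16 * M ^+ 2.
  rewrite -(real_normK (num_real d)).
  have -> : 16 * M ^+ 2 = (4 * M) ^+ 2 by ring.
  by rewrite lerXn2r ?nnegrE //; lra.
have kM : k * M <= 1 / 2.
  have : 1 + 2 * M <= expR (2 * M) := expR_ge1Dx _.
  have : k * expR (2 * M) = 1 by rewrite -expRD -[RHS]expR0; congr expR; field.
  nra.
have pq4 : p * q <= 1 / 4 by have := sqr_ge0 (p - q); rewrite /q; nra.
have z1 : z <= 1.
  have : z <= (k ^+ 2 / 4) * (1 / 4) * (16 * M ^+ 2).
    by apply: ler_pM => //; [exact: mulr_ge0|exact: ler_wpM2l].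
  have : (k * M) ^+ 2 <= 1.
    by rewrite expr_le1 // ?mulr_ge0 //; lra.
  rewrite exprMn; lra.
apply: (@le_trans _ _ (z / 2)).
  have -> : expR (- (8 * M)) = (k ^+ 2) * (k ^+ 2).
    by rewrite k2 -expRD; congr expR; field.
  have h4 : k ^+ 2 / 4 <= p * q.
    have -> : k ^+ 2 / 4 = (k / 2) * (k / 2) by field.
    by rewrite ler_pM //; lra.
  have -> : z / 2 = (k ^+ 2 / 8) * (p * q) * d ^+ 2 by rewrite /z /m; field.
  rewrite ler_wpM2r //.
  have -> : k ^+ 2 * k ^+ 2 / 32 = (k ^+ 2 / 8) * (k ^+ 2 / 4) by field.
  by rewrite ler_wpM2l // divr_ge0 ?sqr_ge0.
apply: le_trans (ln_add1_ge z0 z1) _.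
by rewrite ler_ln ?posrE //; lra.
Qed.

End SoftPlus.

(** * Spin flips and integration by parts for the Ising measure *)

Section IsingModel.
Context {R : realType} {n : nat}.
Implicit Types (x : config n) (i j k : 'I_n) (J : 'M[R]_n) (H : config n -> R).

Definition spin x i : R := if x i then 1 else -1.

Definition flip i x : config n := [ffun k => if k == i then ~~ x k else x k].

Lemma flipK i : involutive (flip i).
Proof. by move=> x; apply/ffunP => k; rewrite !ffunE; case: eqP => // _; rewrite negbK. Qed.

Lemma spin_flip i x k : spin (flip i x) k = if k == i then - spin x k else spin x k.
Proof. by rewrite /spin ffunE; case: eqP => // _; case: (x k); rewrite /= ?opprK. Qed.

Lemma spin_sqr x i : spin x i * spin x i = 1.
Proof. by rewrite /spin; case: (x i); rewrite ?mulrNN mulr1. Qed.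

Lemma norm_spin x i : `|spin x i| = 1.
Proof. by rewrite /spin; case: (x i); rewrite ?normrN normr1. Qed.

Lemma spin_increment i x k :
  spin x k - spin (flip i x) k = if k == i then 2 * spin x i else 0.
Proof. by rewrite spin_flip; case: eqP => [->|_]; [ring|rewrite subrr]. Qed.

Lemma mulv_spin_increment J i x k :
  mulv J (spin x) k - mulv J (spin (flip i x)) k = 2 * spin x i * J k i.
Proof.
rewrite mulvB /mulv (bigD1 i) //= spin_increment eqxx big1 => [|j ji]; first by ring.
by rewrite spin_increment (negbTE ji) mulr0.
Qed.

Lemma mulv_spin_flip J i x : J i i = 0 -> mulv J (spin (flip i x)) i = mulv J (spin x) i.
Proof. by move=> J0; apply/eqP; rewrite eq_sym -subr_eq0 mulv_spin_increment J0 mulr0. Qed.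

Lemma energyE J x : ((spins x)^T *m J *m spins x) 0 0 = dot (spin x) (mulv J (spin x)) :> R.
Proof.
rewrite -mulmxA mxE; apply: eq_bigr => i _; rewrite !mxE; congr (_ * _).
by apply: eq_bigr => j _; rewrite !mxE.
Qed.

Lemma ising_weight_gt0 J x : 0 < ising_weight J x.
Proof. exact: expR_gt0. Qed.

Lemma ising_weight_flip J i x : interaction_matrix J ->
  ising_weight J (flip i x) =
    ising_weight J x * expR (- (2 * spin x i * mulv J (spin x) i)).
Proof.
move=> [JT J0]; rewrite /ising_weight !energyE -expRD; congr expR.
suff : dot (spin x) (mulv J (spin x)) - dot (spin (flip i x)) (mulv J (spin (flip i x))) =
    4 * spin x i * mulv J (spin x) i by move=> h; lra.
rewrite form_diff //.
have one v : dot (fun k => spin x k - spin (flip i x) k) v = 2 * spin x i * v i.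
  rewrite /dot (bigD1 i) //= spin_increment eqxx big1 ?addr0 // => k ki.
  by rewrite spin_increment (negbTE ki) mul0r.
by rewrite !one mulv_spin_flip //; ring.
Qed.

Lemma partition_gt0 J : 0 < \sum_(y : config n) ising_weight J y.
Proof.
pose x0 : config n := [ffun=> true].
rewrite (bigD1 x0) //= ltr_wpDr ?ising_weight_gt0 // sumr_ge0 // => y _.
exact: ltW (ising_weight_gt0 _ _).
Qed.

Lemma ising_pmf_gt0 J x : 0 < ising_pmf J x.
Proof. by rewrite divr_gt0 ?ising_weight_gt0 ?partition_gt0. Qed.

Lemma sum_ising_pmf J : \sum_x ising_pmf J x = 1.
Proof. by rewrite -mulr_suml divff // gt_eqF ?partition_gt0. Qed.

(** Given the other spins, the probability that spin [i] is [- spin x i]. *)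
Definition flip_prob J x i : R := (1 + expR (2 * spin x i * mulv J (spin x) i))^-1.

(** Equal to [spin x i - tanh (mulv J (spin x) i)], the spin minus its
    conditional mean given the other spins. *)
Definition residual J x i : R := 2 * spin x i * flip_prob J x i.

Lemma flip_prob_gt0 J x i : 0 < flip_prob J x i.
Proof. by rewrite invr_gt0 add1expR_gt0. Qed.

Lemma flip_prob_le1 J x i : flip_prob J x i <= 1.
Proof. by rewrite invf_le1 ?add1expR_gt0 // lerDl expR_ge0. Qed.

Lemma norm_residual J x i : `|residual J x i| <= 2.
Proof.
rewrite !normrM norm_spin mulr1 (gtr0_norm (flip_prob_gt0 _ _ _)) ger0_norm //.
by have := flip_prob_le1 J x i; lra.
Qed.

Lemma flip_prob_flip J x i : J i i = 0 -> flip_prob J (flip i x) i = 1 - flip_prob J x i.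
Proof.
move=> J0; rewrite /flip_prob mulv_spin_flip // spin_flip eqxx.
have -> : 2 * - spin x i * mulv J (spin x) i = - (2 * spin x i * mulv J (spin x) i) by ring.
rewrite expRN; field.
by rewrite !gt_eqF ?add1expR_gt0 ?expR_gt0.
Qed.

Lemma detailed_balance J x i : interaction_matrix J ->
  ising_pmf J (flip i x) * flip_prob J (flip i x) i = ising_pmf J x * flip_prob J x i.
Proof.
move=> hJ; rewrite flip_prob_flip; last exact: hJ.2.
have := partition_gt0 J; rewrite /ising_pmf ising_weight_flip // /flip_prob expRN.
set Z := \sum_y _ => Z0; set t := 2 * _ * _.
have t0 : expR t != 0 by rewrite gt_eqF ?expR_gt0.
have t1 : 1 + expR t != 0 by rewrite gt_eqF ?add1expR_gt0.
by field; rewrite t0 t1 (gt_eqF Z0).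
Qed.

Definition expect J H : R := \sum_x ising_pmf J x * H x.

Lemma expect_le J H H' : (forall x, H x <= H' x) -> expect J H <= expect J H'.
Proof.
by move=> h; apply: ler_sum => x _; rewrite ler_wpM2l // ltW ?ising_pmf_gt0.
Qed.

Lemma expectD J H H' : expect J (fun x => H x + H' x) = expect J H + expect J H'.
Proof. by rewrite /expect -big_split; apply: eq_bigr => x _; rewrite mulrDr. Qed.

Lemma expect_sum J (F : 'I_n -> config n -> R) :
  expect J (fun x => \sum_i F i x) = \sum_i expect J (F i).
Proof.
by rewrite /expect exchange_big /=; apply: eq_bigr => x _; rewrite mulr_sumr.
Qed.

(** The value at [0] of the convex function [theta |-> exp (theta * X)] is
    above its tangent line at [theta], so that a nonpositive derivative of the
    moment generating function at [theta] bounds its value there by [1]. *)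
Lemma expect_exp_le1 J (X : config n -> R) (t : R) : 0 <= t ->
  expect J (fun x => X x * expR (t * X x)) <= 0 ->
  expect J (fun x => expR (t * X x)) <= 1.
Proof.
move=> t0 hX.
have pt x : expR (t * X x) <= 1 + t * (X x * expR (t * X x)).
  have := expR_ge1Dx (- (t * X x)); rewrite expRN.
  have := expR_gt0 (t * X x); set z := expR _ => z0 h.
  have := ler_wpM2l (ltW z0) h; rewrite divff ?gt_eqF //; lra.
apply: le_trans (expect_le J pt) _.
rewrite expectD; have -> : expect J (fun=> 1) = 1.
  by rewrite /expect; under eq_bigr do rewrite mulr1; exact: sum_ising_pmf.
have -> : expect J (fun x => t * (X x * expR (t * X x))) =
    t * expect J (fun x => X x * expR (t * X x)).
  by rewrite /expect mulr_sumr; apply: eq_bigr => x _; ring.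
by rewrite gerDl mulr_ge0_le0.
Qed.

(** Integration by parts: summing over the pairs [x], [flip i x], which the
    chain resampling the spin [i] exchanges reversibly, only the part of [H]
    that is odd in [x i] survives against the residual. *)
Lemma integration_by_parts J H i : interaction_matrix J ->
  expect J (fun x => H x * residual J x i) =
  expect J (fun x => flip_prob J x i * spin x i * (H x - H (flip i x))).
Proof.
move=> hJ; pose S := \sum_x ising_pmf J x * flip_prob J x i * spin x i * H x.
have SN : \sum_x ising_pmf J x * flip_prob J x i * spin x i * H (flip i x) = - S.
  rewrite (reindex_inj (inv_inj (flipK i))) /S -sumrN /=; apply: eq_bigr => x _.
  by rewrite flipK detailed_balance // spin_flip eqxx; ring.
transitivity (S - - S); last first.
  rewrite -SN /S -sumrB; apply: eq_bigr => x _; ring.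
rewrite opprK /S -big_split; apply: eq_bigr => x _ /=; rewrite /residual; ring.
Qed.

(** The spin [i] itself moves the residual [i] by [2]; on the other residuals it
    acts only through the local field, of which [flip_prob] is a Lipschitz
    function. *)
Lemma residual_increment J i x k : interaction_matrix J ->
  `|residual J x k - residual J (flip i x) k| <= 2 * (k == i)%:R + 8 * `|J k i|.
Proof.
move=> [_ J0]; have [->|ki] := eqVneq k i.
  rewrite J0 normr0 mulr0 addr0 mulr1 /residual flip_prob_flip // spin_flip eqxx.
  have -> : 2 * spin x i * flip_prob J x i - 2 * - spin x i * (1 - flip_prob J x i) =
    2 * spin x i by ring.
  by rewrite normrM norm_spin mulr1 ger0_norm.
rewrite mulr0 add0r /residual spin_flip (negbTE ki) -mulrBr normrM normrM norm_spin.
rewrite mulr1 ger0_norm // /flip_prob.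
apply: (@le_trans _ _ (2 * (4 * `|J k i|))); last by lra.
rewrite ler_wpM2l //; apply: le_trans (sigmoid_lip _ _) _.
rewrite spin_flip (negbTE ki) -mulrBr mulv_spin_increment !normrM !norm_spin ger0_norm //.
lra.
Qed.

Lemma agree_offE i x : agree_off i x = [set x; flip i x]%SET.
Proof.
apply/setP => y; rewrite !inE; apply/forallP/idP.
  move=> h; have agree k : k != i -> y k = x k.
    by move=> ki; have := h k; rewrite ki => /eqP.
  have [yx|yx] := eqVneq (y i) (x i); apply/orP; [left|right]; apply/eqP/ffunP => k.
    by have [->|/agree] := eqVneq k i.
  rewrite ffunE; have [->|/agree//] := eqVneq k i.
  by move: yx; case: (y i); case: (x i).
case/orP => /eqP -> k; apply/implyP => ki //.
by rewrite ffunE (negbTE ki).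
Qed.

Lemma flip_neq i x : flip i x != x.
Proof.
apply/eqP => /ffunP/(_ i); rewrite ffunE eqxx; by case: (x i).
Qed.

Lemma ising_condE J i x : interaction_matrix J ->
  ising_cond J i x = (1 + expR (- (2 * spin x i * mulv J (spin x) i)))^-1.
Proof.
move=> hJ; rewrite /ising_cond agree_offE.
have -> : [set y in [set x; flip i x] | y i == x i]%SET = [set x]%SET.
  apply/setP => y; rewrite !inE; have [->|yx /=] := eqVneq y x; first by rewrite eqxx.
  apply/negP => /andP[/eqP -> ]; rewrite ffunE eqxx; by case: (x i).
rewrite /ising_prob big_set1 big_setU1 ?inE 1?eq_sym ?flip_neq //= big_set1.
have := partition_gt0 J; rewrite /ising_pmf ising_weight_flip //.
set Z := \sum_y _ => Z0; set t := - _.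
have t1 : 1 + expR t != 0 by rewrite gt_eqF ?add1expR_gt0.
have w0 : ising_weight J x != 0 by rewrite gt_eqF ?ising_weight_gt0.
have -> : ising_weight J x / Z / (ising_weight J x / Z + ising_weight J x * expR t / Z)
    = ising_weight J x / (ising_weight J x * (1 + expR t)).
  by rewrite mulrDr mulr1 -mulrDl invf_div mulrA mulfVK // gt_eqF.
by rewrite invfM mulrA divff // mul1r.
Qed.

Lemma neg_log_plE J x : interaction_matrix J ->
  neg_log_pl x J = \sum_i softplus (- (2 * spin x i * mulv J (spin x) i)).
Proof.
move=> hJ; rewrite /neg_log_pl -sumrN; apply: eq_bigr => i _.
by rewrite ising_condE // lnV ?posrE ?add1expR_gt0 // opprK.
Qed.

Lemma infty_norm_row J i : \sum_j `|J i j| <= infty_norm J.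
Proof. exact: (le_bigmax _ (fun i => \sum_j `|J i j|) i). Qed.

End IsingModel.

(** * The exponential moment of the potential *)

Section ExponentialMoment.
Context {R : realType} {n : nat}.
Variables (J A : 'M[R]_n) (kap : R).
Implicit Types (x : config n) (i j k l : 'I_n).

(** A common bound on the change of the coordinate [i] of the spins and of the
    residuals when the spin [j] is flipped. *)
Definition influence i j : R := 2 * (i == j)%:R + 8 * `|J i j|.

Hypothesis hJ : interaction_matrix J.
Hypothesis hA : interaction_matrix A.
Hypothesis kap_ge1 : 1 <= kap.
Hypothesis row_A : forall i, \sum_j `|A i j| <= kap.
Hypothesis row_influence : forall i, \sum_j influence i j <= kap.
Hypothesis flip_prob_ge : forall x i, kap^-1 <= flip_prob J x i.

Local Notation E := influence.
Local Notation A2 := (A *m A).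
Local Notation s := (@spin R n).
Local Notation e := (residual J).
Local Notation r := (row_norm A).

Let kap_gt0 : 0 < kap. Proof. exact: lt_le_trans kap_ge1. Qed.
Let kap_ge0 : 0 <= kap. Proof. exact: ltW. Qed.
Let kapX m : 1 <= kap ^+ m. Proof. exact: exprn_ege1. Qed.
Let AT : A^T = A. Proof. exact: hA.1. Qed.
Let A2T : A2^T = A2. Proof. by rewrite trmx_mul AT. Qed.

Lemma influence_ge0 i j : 0 <= E i j.
Proof. by rewrite /E addr_ge0 // mulr_ge0. Qed.

Lemma influence_sym i j : E i j = E j i.
Proof. by rewrite /E eq_sym -{1}hJ.1 mxE. Qed.

Let E0 := influence_ge0.

Lemma col_influence j : \sum_i E i j <= kap.
Proof. by rewrite (eq_bigr _ (fun i _ => influence_sym i j)). Qed.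

Lemma spin_influence j x k : `|s x k - s (flip j x) k| <= E j k.
Proof.
rewrite spin_increment /E eq_sym; case: eqP => _ /=; last first.
  by rewrite normr0 mulr0 add0r mulr_ge0.
by rewrite mulr1 normrM norm_spin mulr1 ger0_norm // lerDl mulr_ge0.
Qed.

Lemma residual_influence j x k : `|e x k - e (flip j x) k| <= E j k.
Proof. by rewrite influence_sym /E; apply: residual_increment. Qed.

Lemma influence_norm_le (v : 'I_n -> R) :
  \sum_j (\sum_k E j k * v k) ^+ 2 <= kap ^+ 2 * \sum_k v k ^+ 2.
Proof. by apply: Schur_test => //; apply: col_influence. Qed.

(** What the estimates of the increments need to know about a matrix; [A] and
    its square share it. *)
Definition row_bounded (P : 'M[R]_n) :=
  P^T = P /\ forall k l, `|P k l| <= kap * r k.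

Lemma row_bounded_A : row_bounded A.
Proof.
split=> // k l; apply: le_trans (entry_le_row_norm _ _ _) _.
by rewrite -[leLHS]mul1r ler_wpM2r ?row_norm_ge0.
Qed.

Lemma row_bounded_A2 : row_bounded A2.
Proof. by split=> // k l; apply: sqrmx_entry_le. Qed.

(** Dominates the second-order term of [form_increment] under a flip of the
    spin [j]. *)
Definition second_order j : R := kap ^+ 2 * \sum_k E j k * r k.

Lemma second_order_ge0 j : 0 <= second_order j.
Proof.
by rewrite mulr_ge0 ?exprn_ge0 // sumr_ge0 // => k _; rewrite mulr_ge0 ?row_norm_ge0.
Qed.

Lemma form_flip_le P (u v : config n -> 'I_n -> R) x j : row_bounded P ->
  (forall k, `|u x k - u (flip j x) k| <= E j k) ->
  (forall k, `|v x k - v (flip j x) k| <= E j k) ->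
  `|dot (u x) (mulv P (v x)) - dot (u (flip j x)) (mulv P (v (flip j x)))| <=
    \sum_k E j k * `|mulv P (v x) k| + \sum_k E j k * `|mulv P (u x) k| + second_order j.
Proof.
move=> [PT Pr] hu hv; apply: (le_trans (form_increment PT hu hv)).
rewrite lerD2l /second_order mulr_sumr; apply: ler_sum => k _.
rewrite mulrCA ler_wpM2l //.
apply: (@le_trans _ _ (\sum_l E j l * `|P k l|)).
  by apply: ler_sum => l _; rewrite mulrC.
have -> : kap ^+ 2 * r k = kap * (kap * r k) by ring.
by apply: sum_mul_le; rewrite ?mulr_ge0 ?row_norm_ge0.
Qed.

Lemma mulv_flip_le P (v : config n -> 'I_n -> R) x j : row_bounded P ->
  (forall k, `|v x k - v (flip j x) k| <= E j k) ->
  `|mulv P (v x) j - mulv P (v (flip j x)) j| <= second_order j.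
Proof.
move=> [PT Pr] hv; rewrite mulvB /second_order mulr_sumr.
apply: le_trans (ler_norm_sum _ _ _) _; apply: ler_sum => k _.
have -> : P j k = P k j by rewrite -{1}PT mxE.
apply: (@le_trans _ _ ((kap * r k) * E j k)).
  by rewrite normrM; apply: ler_pM.
rewrite [leRHS]mulrA [leRHS]mulrAC ler_wpM2r // ler_wpM2r ?row_norm_ge0 //.
by rewrite expr2 ler_peMl.
Qed.

Definition sqr_frobenius : R := \sum_i r i ^+ 2.
Definition spin_energy x : R := \sum_i mulv A (s x) i ^+ 2.
Definition residual_energy x : R := \sum_i mulv A (e x) i ^+ 2.
Local Notation Q := spin_energy.
Local Notation V := residual_energy.

Lemma sqr_frobenius_ge0 : 0 <= sqr_frobenius.
Proof. by apply: sumr_ge0 => i _; rewrite sqr_ge0. Qed.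
Lemma spin_energy_ge0 x : 0 <= Q x.
Proof. by apply: sumr_ge0 => i _; rewrite sqr_ge0. Qed.
Lemma residual_energy_ge0 x : 0 <= V x.
Proof. by apply: sumr_ge0 => i _; rewrite sqr_ge0. Qed.

Lemma mulv_A2_norm_le (v : 'I_n -> R) :
  \sum_i mulv A2 v i ^+ 2 <= kap ^+ 2 * \sum_i mulv A v i ^+ 2.
Proof.
under eq_bigr do rewrite mulv_mulmx.
exact: mulv_norm_le.
Qed.

Lemma second_order_norm_le : \sum_j second_order j ^+ 2 <= kap ^+ 6 * sqr_frobenius.
Proof.
under eq_bigr do rewrite exprMn.
rewrite -mulr_sumr.
have -> : kap ^+ 6 * sqr_frobenius = (kap ^+ 2) ^+ 2 * (kap ^+ 2 * sqr_frobenius) by ring.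
by rewrite ler_wpM2l ?sqr_ge0 // influence_norm_le.
Qed.

Let c : R := kap^-1.
Let a : R := c ^+ 3 / 2.
Let b : R := c ^+ 5 / 8.
Let c_gt0 : 0 < c. Proof. by rewrite invr_gt0. Qed.
Let c_le1 : c <= 1. Proof. by rewrite invf_le1. Qed.
Let cX m : 0 <= c ^+ m <= 1.
Proof. by rewrite exprn_ge0 ?exprn_ile1 // ltW. Qed.
Let a_small : 0 <= a <= 1 / 2. Proof. have := cX 3; rewrite /a; lra. Qed.
Let b_small : 0 <= b <= 1 / 2. Proof. have := cX 5; rewrite /b; lra. Qed.
Let b2_small : 0 <= 2 * b <= 1 / 2. Proof. have := cX 5; rewrite /b; lra. Qed.
Let c_small : 0 <= c / 2 <= 1 / 2. Proof. have := cX 1; rewrite expr1; lra. Qed.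

(** With [y = mulv A (spin x)] and [z = mulv A (residual J x)], this is
    [dot y e - a * dot y z + b * dot z z - c / 2 * dot y y] for the residual
    [e]. The first term is the directional derivative of the pseudo-likelihood
    and has mean zero. The second term forces the mean to be negative:
    [dot y z] has mean at least a multiple of the squared Frobenius norm of [A].
    The last two complete the square, so that the second term is dominated
    pointwise by the strong convexity of the pseudo-likelihood. *)
Definition potential x : R :=
  dot (s x) (mulv A (e x)) - a * dot (s x) (mulv A2 (e x))
  + b * dot (e x) (mulv A2 (e x)) - c / 2 * dot (s x) (mulv A2 (s x)).

(** The vector that is integrated by parts against the residual. The coefficient
    of its last term is twice that of the potential: the surplus leaves a
    negative multiple of the residual energy, see [potentialE], which absorbs the
    residual energy in the error terms. *)
Definition drift x j : R :=
  mulv A (s x) j - a * mulv A2 (s x) j + 2 * b * mulv A2 (e x) j.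

Lemma potentialE x :
  potential x = dot (drift x) (e x) - b * V x - c / 2 * Q x.
Proof.
rewrite /potential [dot (e x) (mulv A2 (e x))]dot_mulmx // dot_sqr.
rewrite [dot (s x) (mulv A2 (s x))]dot_mulmx // dot_sqr -/(Q x) -/(V x).
have -> : dot (drift x) (e x) = dot (s x) (mulv A (e x)) - a * dot (s x) (mulv A2 (e x))
    + 2 * b * V x.
  rewrite /V -[\sum_i _]dot_sqr -dot_mulmx // mulv_adjoint // [dot (s x) (mulv A2 _)]mulv_adjoint //.
  rewrite [dot (e x) _]mulv_adjoint // /dot !mulr_sumr -sumrB -big_split /=.
  by apply: eq_bigr => i _; rewrite /drift; ring.
by ring.
Qed.

(** The first- and second-order terms of [form_increment] for all the forms in
    the potential. *)
Definition sensitivity x j : R :=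
  \sum_k E j k * `|mulv A (s x) k| + \sum_k E j k * `|mulv A (e x) k|
  + \sum_k E j k * `|mulv A2 (s x) k| + \sum_k E j k * `|mulv A2 (e x) k|
  + second_order j.

Lemma potential_flip_le x j :
  `|potential x - potential (flip j x)| <= 4 * sensitivity x j.
Proof.
have hs k := spin_influence j x k; have he k := residual_influence j x k.
have h1 := form_flip_le row_bounded_A hs he.
have h2 := form_flip_le row_bounded_A2 hs he.
have h3 := form_flip_le row_bounded_A2 he he.
have h4 := form_flip_le row_bounded_A2 hs hs.
have := second_order_ge0 j.
have E1 : 0 <= \sum_k E j k * `|mulv A (s x) k| by apply: sumr_ge0 => k _; rewrite mulr_ge0.
have E2 : 0 <= \sum_k E j k * `|mulv A (e x) k| by apply: sumr_ge0 => k _; rewrite mulr_ge0.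
have E3 : 0 <= \sum_k E j k * `|mulv A2 (s x) k| by apply: sumr_ge0 => k _; rewrite mulr_ge0.
have E4 : 0 <= \sum_k E j k * `|mulv A2 (e x) k| by apply: sumr_ge0 => k _; rewrite mulr_ge0.
rewrite /potential /sensitivity; move: h1 h2 h3 h4 E1 E2 E3 E4.
set S1 := \sum_k _; set S2 := \sum_k _; set S3 := \sum_k _; set S4 := \sum_k _.
set d1 := dot _ _; set d1' := dot _ _; set d2 := dot _ _; set d2' := dot _ _.
set d3 := dot _ _; set d3' := dot _ _; set d4 := dot _ _; set d4' := dot _ _.
move=> h1 h2 h3 h4 E1 E2 E3 E4 so0.
have -> : d1 - a * d2 + b * d3 - c / 2 * d4 - (d1' - a * d2' + b * d3' - c / 2 * d4') =
  (d1 - d1') - a * (d2 - d2') + b * (d3 - d3') - c / 2 * (d4 - d4') by ring.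
have k2 : `|a * (d2 - d2')| <= _ := norm_scale_le a_small h2.
have k3 : `|b * (d3 - d3')| <= _ := norm_scale_le b_small h3.
have k4 : `|c / 2 * (d4 - d4')| <= _ := norm_scale_le c_small h4.
apply: le_trans (ler_normB _ _) _; apply: le_trans (lerD (ler_normD _ _) (lexx _)) _.
have := ler_normB (d1 - d1') (a * (d2 - d2')).
lra.
Qed.

Lemma sensitivity_norm_le x :
  \sum_j sensitivity x j ^+ 2 <= 10 * kap ^+ 6 * (Q x + V x + sqr_frobenius).
Proof.
have five (t1 t2 t3 t4 t5 : R) : (t1 + t2 + t3 + t4 + t5) ^+ 2 <=
    5 * (t1 ^+ 2 + t2 ^+ 2 + t3 ^+ 2 + t4 ^+ 2 + t5 ^+ 2).
  have := sqr_ge0 (t1 - t2); have := sqr_ge0 (t1 - t3); have := sqr_ge0 (t1 - t4).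
  have := sqr_ge0 (t1 - t5); have := sqr_ge0 (t2 - t3); have := sqr_ge0 (t2 - t4).
  have := sqr_ge0 (t2 - t5); have := sqr_ge0 (t3 - t4); have := sqr_ge0 (t3 - t5).
  have := sqr_ge0 (t4 - t5); rewrite !sqrrB; lra.
apply: le_trans (ler_sum _ (fun j _ => five _ _ _ _ _)) _.
rewrite -mulr_sumr !big_split /=.
have avg (v : 'I_n -> R) : \sum_j (\sum_k E j k * `|v k|) ^+ 2 <= kap ^+ 2 * \sum_k v k ^+ 2.
  apply: le_trans (influence_norm_le _) _.
  by rewrite (eq_bigr _ (fun k _ => real_normK (num_real (v k)))).
have h1 := avg (mulv A (s x)); have h2 := avg (mulv A (e x)).
have h3 := avg (mulv A2 (s x)); have h4 := avg (mulv A2 (e x)).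
have h3' := mulv_A2_norm_le (s x); have h4' := mulv_A2_norm_le (e x).
have h5 := second_order_norm_le.
rewrite -/(Q x) -/(V x) in h1 h2 h3' h4'.
have Q0 := spin_energy_ge0 x; have V0 := residual_energy_ge0 x; have F0 := sqr_frobenius_ge0.
have up (m p : nat) (y : R) : 0 <= y -> (m <= p)%N -> kap ^+ m * y <= kap ^+ p * y.
  by move=> y0 mp; rewrite ler_wpM2r // ler_weXn2l.
have step (X Y : R) : X <= kap ^+ 2 * Y -> kap ^+ 2 * X <= kap ^+ 4 * Y.
  move=> XY; have -> : kap ^+ 4 * Y = kap ^+ 2 * (kap ^+ 2 * Y) by ring.
  by rewrite ler_wpM2l // sqr_ge0.
have := step _ _ h3'; have := step _ _ h4'.
have := up 2%N 6%N _ Q0 isT; have := up 2%N 6%N _ V0 isT.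
have := up 4%N 6%N _ Q0 isT; have := up 4%N 6%N _ V0 isT.
have := up 0%N 6%N _ F0 isT; rewrite expr0 mul1r.
rewrite -!mulrA !mulrDr; lra.
Qed.

Lemma sensitivity_sup_le x j : sensitivity x j <= 7 * kap ^+ 4.
Proof.
have c1 k : `|s x k| <= 1 by rewrite norm_spin.
have c2 k : `|e x k| <= 2 := norm_residual J x k.
have avg (v : 'I_n -> R) d : 0 <= d -> (forall k, v k <= d) -> \sum_k E j k * v k <= kap * d.
  by move=> d0 vd; apply: sum_mul_le.
have up (m : nat) : (m <= 4)%N -> kap ^+ m <= kap ^+ 4 by move=> mp; rewrite ler_weXn2l.
have sup1 k : `|mulv A (s x) k| <= kap * 1 by apply: mulv_sup_le.
have sup2 k : `|mulv A (e x) k| <= kap * 2 by apply: mulv_sup_le.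
have sup3 k : `|mulv A2 (s x) k| <= kap * (kap * 1).
  by rewrite mulv_mulmx; apply: mulv_sup_le; rewrite ?mulr_ge0.
have sup4 k : `|mulv A2 (e x) k| <= kap * (kap * 2).
  by rewrite mulv_mulmx; apply: mulv_sup_le; rewrite ?mulr_ge0.
have h1 := avg _ _ (mulr_ge0 kap_ge0 ler01) sup1.
have h2 := avg _ _ (mulr_ge0 kap_ge0 (ler0n R 2)) sup2.
have h3 := avg _ _ (mulr_ge0 kap_ge0 (mulr_ge0 kap_ge0 ler01)) sup3.
have h4 := avg _ _ (mulr_ge0 kap_ge0 (mulr_ge0 kap_ge0 (ler0n R 2))) sup4.
have h5 : second_order j <= kap ^+ 2 * (kap * kap).
  rewrite ler_wpM2l ?sqr_ge0 //; apply: avg => // k; exact: row_norm_le.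
have := up 2%N isT; have := up 3%N isT.
rewrite /sensitivity; move: h1 h2 h3 h4 h5.
have -> : kap * (kap * 1) = kap ^+ 2 by ring.
have -> : kap * (kap * 2) = 2 * kap ^+ 2 by ring.
have -> : kap * kap ^+ 2 = kap ^+ 3 by ring.
have -> : kap * (2 * kap ^+ 2) = 2 * kap ^+ 3 by ring.
have -> : kap ^+ 2 * (kap * kap) = kap ^+ 4 by ring.
lra.
Qed.

Lemma drift_flip_norm_le x :
  \sum_j drift (flip j x) j ^+ 2 <= 36 * kap ^+ 6 * (Q x + V x + sqr_frobenius).
Proof.
have four (t1 t2 t3 t4 : R) : (t1 + t2 + t3 + t4) ^+ 2 <=
    4 * (t1 ^+ 2 + t2 ^+ 2 + t3 ^+ 2 + t4 ^+ 2).
  have := sqr_ge0 (t1 - t2); have := sqr_ge0 (t1 - t3); have := sqr_ge0 (t1 - t4).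
  have := sqr_ge0 (t2 - t3); have := sqr_ge0 (t2 - t4); have := sqr_ge0 (t3 - t4).
  rewrite !sqrrB; lra.
have := cX 3; have := cX 5 => /andP[b0 b1] /andP[a0 a1].
have pt j : drift (flip j x) j ^+ 2 <= 4 * (mulv A (s x) j ^+ 2 + mulv A2 (s x) j ^+ 2
    + mulv A2 (e x) j ^+ 2 + (3 * second_order j) ^+ 2).
  have hs k := spin_influence j x k; have he k := residual_influence j x k.
  have d1 := mulv_flip_le row_bounded_A hs.
  have d2 := mulv_flip_le row_bounded_A2 hs.
  have d3 := mulv_flip_le row_bounded_A2 he.
  pose y4 := drift (flip j x) j - drift x j.
  have hy4 : `|y4| <= 3 * second_order j.
    have -> : y4 = - (mulv A (s x) j - mulv A (s (flip j x)) j)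
      + a * (mulv A2 (s x) j - mulv A2 (s (flip j x)) j)
      - 2 * b * (mulv A2 (e x) j - mulv A2 (e (flip j x)) j) by rewrite /y4 /drift; ring.
    have k2 : `|a * _| <= _ := norm_scale_le a_small d2.
    have k3 : `|2 * b * _| <= _ := norm_scale_le b2_small d3.
    apply: le_trans (ler_normB _ _) _; apply: le_trans (lerD (ler_normD _ _) (lexx _)) _.
    by rewrite normrN; have := second_order_ge0 j; lra.
  have -> : drift (flip j x) j = mulv A (s x) j + - a * mulv A2 (s x) j
      + 2 * b * mulv A2 (e x) j + y4 by rewrite /y4 /drift; ring.
  apply: le_trans (four _ _ _ _) _; rewrite ler_wpM2l //.
  have sq (t y : R) : 0 <= t <= 1 -> (t * y) ^+ 2 <= y ^+ 2.
    move=> /andP[t0 t1]; rewrite exprMn -[leRHS]mul1r ler_wpM2r ?sqr_ge0 //.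
    exact: exprn_ile1.
  rewrite !lerD //.
  - by rewrite mulNr sqrrN sq // /a; lra.
  - by rewrite sq // /b; lra.
  - by rewrite -[leLHS]real_normK ?num_real // lerXn2r ?nnegrE // (le_trans _ hy4).
apply: le_trans (ler_sum _ (fun j _ => pt j)) _.
rewrite -mulr_sumr !big_split /= -/(Q x).
have h3' := mulv_A2_norm_le (s x); have h4' := mulv_A2_norm_le (e x).
have h5 := second_order_norm_le.
rewrite -/(Q x) -/(V x) in h3' h4'.
have Q0 := spin_energy_ge0 x; have V0 := residual_energy_ge0 x; have F0 := sqr_frobenius_ge0.
have up (m p : nat) (y : R) : 0 <= y -> (m <= p)%N -> kap ^+ m * y <= kap ^+ p * y.
  by move=> y0 mp; rewrite ler_wpM2r // ler_weXn2l.
have := up 2%N 6%N _ Q0 isT; have := up 2%N 6%N _ V0 isT.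
have := up 0%N 6%N _ Q0 isT; rewrite expr0 mul1r.
have := up 0%N 6%N _ V0 isT; rewrite expr0 mul1r.
have -> : \sum_j (3 * second_order j) ^+ 2 = 9 * \sum_j second_order j ^+ 2.
  by rewrite mulr_sumr; apply: eq_bigr => j _; ring.
rewrite -!mulrA !mulrDr; lra.
Qed.

(** The main term of the integration by parts. The part [mulv A (spin x) j] of
    the drift does not see the spin [j] because the diagonal of [A] vanishes;
    flipping the spin [j] changes [mulv (A *m A) (spin x) j] by twice the diagonal
    entry [row_norm A j ^+ 2], always with the same sign, and [b] is small enough
    for the third part to lose only a quarter of this gain. *)
Lemma drift_divergence_le x :
  \sum_j flip_prob J x j * s x j * (drift x j - drift (flip j x) j) <=
  - (3 / 4 * c ^+ 4) * sqr_frobenius.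
Proof.
have pt j : flip_prob J x j * s x j * (drift x j - drift (flip j x) j) <=
    - (2 * a * c) * r j ^+ 2 + b * \sum_k E j k * (r j ^+ 2 + r k ^+ 2).
  have q0 := flip_prob_gt0 J x j; have q1 := flip_prob_le1 J x j.
  have qc := flip_prob_ge x j; rewrite -/c in qc.
  pose y := mulv A2 (e x) j - mulv A2 (e (flip j x)) j.
  have hy : `|y| <= (\sum_k E j k * (r j ^+ 2 + r k ^+ 2)) / 2.
    rewrite /y mulvB mulr_suml; apply: le_trans (ler_norm_sum _ _ _) _.
    apply: ler_sum => k _; rewrite normrM mulrC -mulrA ler_pM //.
      exact: residual_influence.
    exact: sqrmx_entry_le_mean.
  have -> : flip_prob J x j * s x j * (drift x j - drift (flip j x) j) =
      - (2 * a) * flip_prob J x j * r j ^+ 2 + 2 * b * (flip_prob J x j * s x j * y).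
    have -> : drift x j - drift (flip j x) j =
       (mulv A (s x) j - mulv A (s (flip j x)) j)
       - a * (mulv A2 (s x) j - mulv A2 (s (flip j x)) j) + 2 * b * y.
      by rewrite /drift /y; ring.
    rewrite !mulv_spin_increment hA.2 sqrmx_diag //.
    have -> : 2 * s x j * 0 - a * (2 * s x j * r j ^+ 2) + 2 * b * y =
      - (2 * a) * s x j * r j ^+ 2 + 2 * b * y by ring.
    rewrite mulrDr.
    have -> : flip_prob J x j * s x j * (- (2 * a) * s x j * r j ^+ 2) =
      - (2 * a) * flip_prob J x j * r j ^+ 2 * (s x j * s x j) by ring.
    by rewrite spin_sqr; ring.
  have := cX 3; have := cX 5 => /andP[b0 b1] /andP[a0 a1].
  apply: lerD.
    rewrite ler_wpM2r ?sqr_ge0 // !mulNr lerN2 ler_wpM2l // /a; lra.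
  have hq : flip_prob J x j * s x j * y <= `|y|.
    apply: le_trans (ler_norm _) _; rewrite !normrM norm_spin mulr1 gtr0_norm //.
    by rewrite -[leRHS]mul1r ler_wpM2r.
  have -> : b * \sum_k E j k * (r j ^+ 2 + r k ^+ 2) =
     2 * b * ((\sum_k E j k * (r j ^+ 2 + r k ^+ 2)) / 2) by field.
  rewrite ler_wpM2l ?(le_trans hq hy) // /b; lra.
apply: le_trans (ler_sum _ (fun j _ => pt j)) _.
rewrite big_split -!mulr_sumr /= -/sqr_frobenius.
have hE : \sum_j \sum_k E j k * (r j ^+ 2 + r k ^+ 2) <= 2 * kap * sqr_frobenius.
  under eq_bigr do under eq_bigr do rewrite mulrDr.
  under eq_bigr do rewrite big_split /=.
  rewrite big_split /= -mulrA mulrDl !mul1r; apply: lerD; last rewrite exchange_big /=;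
    rewrite /sqr_frobenius mulr_sumr; apply: ler_sum => j _; rewrite -mulr_suml;
    by rewrite ler_wpM2r ?sqr_ge0 // col_influence.
have kc : kap * c = 1 by rewrite divff // gt_eqF.
have := cX 5 => /andP[b0 _].
have := ler_wpM2l b0 hE.
have -> : c ^+ 5 * (2 * kap * sqr_frobenius) = 2 * c ^+ 4 * (kap * c) * sqr_frobenius by ring.
rewrite kc /a /b.
have -> : - (2 * (c ^+ 3 / 2) * c) * sqr_frobenius = - (c ^+ 4 * sqr_frobenius) by field.
lra.
Qed.

(** Small enough for the errors of [expect_exp_potential], of total size
    [200 * kap ^+ 6] times the energies, to be absorbed by [b]. *)
Definition rate : R := c ^+ 11 / 1600.
Local Notation theta := rate.

(** The derivative of the moment generating function is the expectation of the
    potential under the tilted weight [g]. Integration by parts turns the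
    product of the drift and the residual into the divergence of the drift,
    which is negative, plus terms in which the flip acts on [g]; these carry a
    factor [rate] and are at most a small multiple of the spin energy, the
    residual energy and the squared Frobenius norm, and each of these three
    appears with a larger negative coefficient. *)
Theorem expect_exp_potential :
  expect J (fun x => expR (theta * (potential x + c ^+ 4 / 2 * sqr_frobenius))) <= 1.
Proof.
have th0 : 0 <= theta by rewrite divr_ge0 ?ler0n // exprn_ge0 // ltW.
apply: expect_exp_le1; first exact: th0.
pose X x := potential x + c ^+ 4 / 2 * sqr_frobenius.
pose g x := expR (theta * X x).
have g0 x : 0 <= g x by exact: expR_ge0.
have kc : kap * c = 1 by rewrite divff // gt_eqF.
have thk6 : theta * (200 * kap ^+ 6) = c ^+ 5 / 8.
  have -> : theta * (200 * kap ^+ 6) = c ^+ 5 / 8 * (kap * c) ^+ 6 by rewrite /theta; field.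
  by rewrite kc expr1n mulr1.
have g_flip x j : `|g x - g (flip j x)| <= theta * (8 * sensitivity x j) * g x.
  pose t := theta * (potential (flip j x) - potential x).
  have -> : g (flip j x) = g x * expR t.
    by rewrite /g /X /t -expRD; congr expR; ring.
  have -> : g x - g x * expR t = (1 - expR t) * g x by ring.
  rewrite normrM (ger0_norm (g0 x)) ler_wpM2r //.
  have ht : `|t| <= theta * (4 * sensitivity x j).
    by rewrite normrM ger0_norm // ler_wpM2l // distrC potential_flip_le.
  apply: le_trans (expR_increment_le _) _; last by lra.
  apply: (le_trans ht).
  apply: (@le_trans _ _ (theta * (28 * kap ^+ 6))).
    rewrite ler_wpM2l //; apply: (@le_trans _ _ (28 * kap ^+ 4)).
      by have := sensitivity_sup_le x j; lra.
    by rewrite ler_wpM2l // ler_weXn2l.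
  by have := cX 5; move: thk6; lra.
have parts : expect J (fun x => dot (drift x) (e x) * g x) =
    expect J (fun x => \sum_j flip_prob J x j * s x j *
      (drift x j * g x - drift (flip j x) j * g (flip j x))).
  rewrite expect_sum -(eq_bigr _ (fun j _ =>
    integration_by_parts (fun x => drift x j * g x) j hJ)) -expect_sum.
  apply: eq_bigr => x _; congr (_ * _); rewrite /dot mulr_suml.
  by apply: eq_bigr => j _; ring.
have pt x : \sum_j flip_prob J x j * s x j *
      (drift x j * g x - drift (flip j x) j * g (flip j x)) <=
    (- (3 / 4 * c ^+ 4) * sqr_frobenius + c ^+ 5 / 8 * (Q x + V x + sqr_frobenius)) * g x.
  have -> : \sum_j flip_prob J x j * s x j *
      (drift x j * g x - drift (flip j x) j * g (flip j x)) =
    (\sum_j flip_prob J x j * s x j * (drift x j - drift (flip j x) j)) * g x +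
    \sum_j flip_prob J x j * s x j * (drift (flip j x) j * (g x - g (flip j x))).
    by rewrite mulr_suml -big_split; apply: eq_bigr => j _ /=; ring.
  rewrite mulrDl; apply: lerD.
    by rewrite ler_wpM2r // drift_divergence_le.
  apply: (@le_trans _ _ (\sum_j theta * (drift (flip j x) j ^+ 2
      + 16 * sensitivity x j ^+ 2) * g x)).
    apply: ler_sum => j _.
    have q0 := flip_prob_gt0 J x j; have q1 := flip_prob_le1 J x j.
    set D := drift (flip j x) j; set S := sensitivity x j.
    apply: (@le_trans _ _ (`|D| * (theta * (8 * S) * g x))).
      apply: le_trans (ler_norm _) _; rewrite !normrM norm_spin mulr1 gtr0_norm //.
      rewrite -[leRHS]mul1r ler_pM ?mulr_ge0 ?(ltW q0) //.
      by rewrite ler_wpM2l // g_flip.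
    have -> : `|D| * (theta * (8 * S) * g x) = theta * (8 * `|D| * S) * g x by ring.
    rewrite ler_wpM2r // ler_wpM2l // -(real_normK (num_real D)).
    by have := sqr_ge0 (`|D| - 4 * S); rewrite sqrrB; lra.
  rewrite -mulr_suml -mulr_sumr ler_wpM2r // -thk6 -mulrA ler_wpM2l //.
  rewrite big_split -mulr_sumr /=.
  have := drift_flip_norm_le x; have := sensitivity_norm_le x.
  have : 0 <= kap ^+ 6 * (Q x + V x + sqr_frobenius).
    by rewrite mulr_ge0 ?exprn_ge0 ?addr_ge0 ?spin_energy_ge0 ?residual_energy_ge0 ?sqr_frobenius_ge0.
  rewrite -!mulrA; lra.
have -> : expect J (fun x => X x * g x) =
    expect J (fun x => dot (drift x) (e x) * g x)
    + expect J (fun x => (c ^+ 4 / 2 * sqr_frobenius - b * V x - c / 2 * Q x) * g x).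
  rewrite -expectD; apply: eq_bigr => x _; congr (_ * _).
  by rewrite /X potentialE; ring.
rewrite parts -expectD.
apply: (@le_trans _ _ (expect J (fun=> 0))); last first.
  by rewrite /expect big1 // => x _; rewrite mulr0.
apply: expect_le => x /=; apply: le_trans (lerD (pt x) (lexx _)) _.
rewrite -mulrDl mulr_le0_ge0 //.
have Q0 := spin_energy_ge0 x; have V0 := residual_energy_ge0 x; have F0 := sqr_frobenius_ge0.
have h1 : c ^+ 5 * sqr_frobenius <= c ^+ 4 * sqr_frobenius.
  by rewrite ler_wpM2r // ler_wiXn2l // ltW.
have h2 : c ^+ 5 * Q x <= c * Q x.
  by rewrite ler_wpM2r // -[leRHS]expr1 ler_wiXn2l // ltW.
have h3 : 0 <= c ^+ 4 * sqr_frobenius by rewrite mulr_ge0 // exprn_ge0 // ltW.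
have h4 : 0 <= c * Q x by rewrite mulr_ge0 // ltW.
rewrite /b; lra.
Qed.

End ExponentialMoment.

(** * Separation of two interaction matrices by the pseudo-likelihood *)

Section TailBound.
Context {R : realType} {n : nat}.
Implicit Types (M : R) (J A : 'M[R]_n) (x : config n).

(** A single constant that dominates the row sums of the interaction and
    influence matrices, the inverse of [flip_prob], and the inverse of the
    strong convexity constant. *)
Definition conditioning M : R := 16 * expR (8 * M).

Lemma conditioning_ge M : 16 + 128 * M <= conditioning M.
Proof.
by rewrite /conditioning; have := @expR_ge1Dx R (8 * M); lra.
Qed.

Lemma field_le M J x i : infty_norm J <= M -> `|2 * spin x i * mulv J (spin x) i| <= 2 * M.
Proof.
move=> JM; rewrite !normrM norm_spin mulr1 ger0_norm // ler_wpM2l //.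
have row k : \sum_j `|J k j| <= M by apply: le_trans (infty_norm_row _ _) JM.
by rewrite -[M]mulr1; apply: mulv_sup_le => // j; rewrite norm_spin.
Qed.

Lemma potential_sum J A kap x : A^T = A -> potential J A kap x =
  \sum_i (mulv A (spin x) i * residual J x i
    - kap^-1 ^+ 3 / 2 * (mulv A (spin x) i * mulv A (residual J x) i)
    + kap^-1 ^+ 5 / 8 * mulv A (residual J x) i ^+ 2
    - kap^-1 / 2 * mulv A (spin x) i ^+ 2).
Proof.
move=> AT.
rewrite /potential !dot_mulmx // mulv_adjoint // !dot_sqr /dot !mulr_sumr -sumrB -big_split -sumrB.
by [].
Qed.

(** Strong convexity in each coordinate gives the linear term of the potential
    minus [2 * c * y ^+ 2]; the remaining terms of the potential are then a
    nonnegative multiple of [y ^+ 2] plus the square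
    [c * (y - c ^+ 2 / 2 * z) ^+ 2 / 2]. *)
Lemma neg_log_pl_decrease_le M J J' x : 0 < M ->
  interaction_matrix J -> interaction_matrix J' ->
  infty_norm J <= M -> infty_norm J' <= M ->
  neg_log_pl x J - neg_log_pl x J' <= potential J (J' - J) (conditioning M) x.
Proof.
move=> M0 hJ hJ' JM JM'.
rewrite potential_sum; last by rewrite linearB /= hJ.1 hJ'.1.
rewrite !neg_log_plE // -sumrB; apply: ler_sum => i _.
have AE : mulv (J' - J) (spin x) i = mulv J' (spin x) i - mulv J (spin x) i.
  by rewrite /mulv -sumrB; apply: eq_bigr => j _; rewrite !mxE mulrBl.
set c := (conditioning M)^-1.
set z := mulv (J' - J) (residual J x) i.
set y := mulv (J' - J) (spin x) i in AE *.
have := @softplus_strongly_convex R M (- (2 * spin x i * mulv J' (spin x) i))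
   (- (2 * spin x i * mulv J (spin x) i)) M0.
rewrite !normrN !field_le // => /(_ isT isT).
have -> : - (2 * spin x i * mulv J' (spin x) i) - - (2 * spin x i * mulv J (spin x) i) =
  - (2 * spin x i * y) by rewrite AE; ring.
rewrite opprK -/(flip_prob J x i) sqrrN !exprMn [spin x i ^+ 2]expr2 spin_sqr mulr1.
have -> : flip_prob J x i * - (2 * spin x i * y) = - (y * residual J x i).
  by rewrite /residual; ring.
have -> : expR (- (8 * M)) / 32 * (2 ^+ 2 * y ^+ 2) = 2 * c * y ^+ 2.
  by rewrite expRN /c /conditioning; field; rewrite gt_eqF ?expR_gt0.
have c0 : 0 < c by rewrite invr_gt0 mulr_gt0 ?expR_gt0.
have : 0 <= c * (y - c ^+ 2 / 2 * z) ^+ 2 / 2.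
  by rewrite divr_ge0 // mulr_ge0 ?sqr_ge0 // ltW.
have -> : c * (y - c ^+ 2 / 2 * z) ^+ 2 / 2 =
  c / 2 * y ^+ 2 - c ^+ 3 / 2 * (y * z) + c ^+ 5 / 8 * z ^+ 2 by field.
have : 0 <= c * y ^+ 2 by rewrite mulr_ge0 ?sqr_ge0 // ltW.
lra.
Qed.

Lemma flip_prob_lower M J x i : 0 < M -> infty_norm J <= M ->
  (conditioning M)^-1 <= flip_prob J x i.
Proof.
move=> M0 JM; have := field_le x i JM.
rewrite lef_pV2 ?posrE ?add1expR_gt0 ?mulr_gt0 ?expR_gt0 // => h.
have h1 : expR (2 * spin x i * mulv J (spin x) i) <= expR (8 * M).
  by rewrite ler_expR (le_trans (ler_norm _)) // (le_trans h) //; lra.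
have h2 : 1 <= expR (8 * M) by rewrite -[leLHS]expR0 ler_expR; lra.
by rewrite /conditioning; lra.
Qed.

Lemma influence_row_le M J i : 0 < M -> infty_norm J <= M ->
  \sum_j influence J i j <= conditioning M.
Proof.
move=> M0 JM; rewrite /influence big_split -!mulr_sumr /= (bigD1 i) //= eqxx.
rewrite big1 => [|j ji]; last by rewrite eq_sym (negbTE ji).
have := infty_norm_row J i; have := conditioning_ge M; rewrite addr0 /=; lra.
Qed.

(** Exponential Markov inequality for the bound on the moment generating
    function of the potential. *)
Lemma pl_separation M J J' (t : R) : 0 < M ->
  interaction_matrix J -> interaction_matrix J' ->
  infty_norm J <= M -> infty_norm J' <= M ->
  ising_prob J [set x | neg_log_pl x J' <= neg_log_pl x J + t]%SET <=
  expR (rate (conditioning M) *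
    (t - (conditioning M)^-1 ^+ 4 / 2 * sqr_frobenius (J' - J))).
Proof.
move=> M0 hJ hJ' JM JM'; set kap := conditioning M; set A := J' - J.
have k16 := conditioning_ge M; rewrite -/kap in k16.
have k1 : 1 <= kap by lra.
have hA : interaction_matrix A.
  split=> [|i]; first by rewrite linearB /= hJ.1 hJ'.1.
  by rewrite !mxE hJ.2 hJ'.2 subrr.
have rowA i : \sum_j `|A i j| <= kap.
  apply: (@le_trans _ _ (M + M)); last by lra.
  apply: (@le_trans _ _ (\sum_j `|J' i j| + \sum_j `|J i j|)).
    by rewrite -big_split; apply: ler_sum => j _; rewrite !mxE ler_normB.
  by apply: lerD; apply: le_trans (infty_norm_row _ _) _.
have := expect_exp_potential hJ hA k1 rowA (fun i => influence_row_le i M0 JM)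
  (fun x i => flip_prob_lower x i M0 JM).
set theta := rate _; set G := _ * sqr_frobenius _ => mgf.
have th0 : 0 <= theta by rewrite divr_ge0 ?ler0n // exprn_ge0 // invr_ge0; lra.
rewrite -[leRHS]mulr1 -[t - G]opprB mulrN expRN.
rewrite ler_pdivlMl ?expR_gt0 //; apply: le_trans mgf.
set S := [set x | _]%SET.
rewrite /ising_prob mulr_sumr [leRHS](bigID (mem S)) /=.
apply: ler_wpDr.
  by apply: sumr_ge0 => x _; rewrite mulr_ge0 ?expR_ge0 // ltW ?ising_pmf_gt0.
apply: ler_sum => x; rewrite inE => hx; rewrite mulrC ler_wpM2l ?(ltW (ising_pmf_gt0 _ _)) //.
rewrite ler_expR ler_wpM2l //.
rewrite [leLHS]addrC lerD2r; apply: le_trans (neg_log_pl_decrease_le x M0 hJ hJ' JM JM').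
by rewrite -/A -/kap lerNl opprB lerBlDl.
Qed.

End TailBound.

(** * The spectral norm *)

Section SpectralNorm.
Context {R : realType} {n : nat}.
Implicit Types (B : 'M[R]_n) (v : 'cV[R]_n) (x : config n).

Lemma euclidean_norm_sqr v : euclidean_norm v ^+ 2 = \sum_i v i 0 ^+ 2.
Proof. by rewrite sqr_sqrtr // sumr_ge0 // => i _; rewrite sqr_ge0. Qed.

Lemma euclidean_normZ (t : R) v : 0 <= t ->
  euclidean_norm (t *: v) = t * euclidean_norm v.
Proof.
move=> t0; rewrite /euclidean_norm.
under eq_bigr do rewrite mxE exprMn.
by rewrite -mulr_sumr sqrtrM ?sqr_ge0 // sqrtr_sqr ger0_norm.
Qed.

Lemma spectral_normP B v : euclidean_norm v <= 1 ->
  euclidean_norm (B *m v) <= spectral_norm B.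
Proof.
move=> v1; apply: ub_le_sup; last by exists v.
exists (Num.sqrt (\sum_i (\sum_j `|B i j|) ^+ 2)) => _ [u /= u1 <-].
rewrite ler_wsqrtr //; apply: ler_sum => i _.
rewrite -[leLHS]real_normK ?num_real // lerXn2r ?nnegrE ?sumr_ge0 //.
rewrite mxE; apply: le_trans (ler_norm_sum _ _ _) _; apply: ler_sum => j _.
rewrite normrM -[leRHS]mulr1 ler_wpM2l // -sqrtr_sqr.
apply: le_trans u1; rewrite ler_wsqrtr // (bigD1 j) //= lerDl sumr_ge0 // => k _.
by rewrite sqr_ge0.
Qed.

Lemma spectral_norm_ge0 B : 0 <= spectral_norm B.
Proof.
apply: (@le_trans _ _ (euclidean_norm (B *m 0))); first exact: sqrtr_ge0.
apply: spectral_normP; rewrite /euclidean_norm big1 ?sqrtr0 // => i _.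
by rewrite mxE expr0n.
Qed.

Lemma sqr_frobeniusE B : sqr_frobenius B = \sum_i \sum_j B i j ^+ 2.
Proof. by apply: eq_bigr => i _; rewrite sqr_row_norm. Qed.

(** Each column is the image of a unit vector. *)
Lemma sqr_frobenius_le_spectral B : sqr_frobenius B <= n%:R * spectral_norm B ^+ 2.
Proof.
rewrite sqr_frobeniusE exchange_big /=.
apply: (@le_trans _ _ (\sum_(j < n) spectral_norm B ^+ 2)); last first.
  by rewrite sumr_const card_ord mulr_natl.
apply: ler_sum => j _.
pose u : 'cV[R]_n := delta_mx j 0.
have u1 : euclidean_norm u <= 1.
  rewrite /euclidean_norm (bigD1 j) //= big1 => [|i ij].
    by rewrite !mxE !eqxx /= expr1n addr0 sqrtr1.
  by rewrite !mxE (negbTE ij) /= expr0n.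
have -> : \sum_i B i j ^+ 2 = euclidean_norm (B *m u) ^+ 2.
  by rewrite euclidean_norm_sqr; apply: eq_bigr => i _; rewrite -colE mxE.
by rewrite lerXn2r ?nnegrE ?sqrtr_ge0 ?spectral_norm_ge0 // spectral_normP.
Qed.

Lemma mulv_spins_le B x : (0 < n)%N ->
  \sum_i mulv B (spin x) i ^+ 2 <= n%:R * spectral_norm B ^+ 2.
Proof.
move=> n0; have n0' : 0 < n%:R :> R by rewrite ltr0n.
have s0 : 0 < Num.sqrt n%:R :> R by rewrite sqrtr_gt0.
have sn : Num.sqrt n%:R ^+ 2 = n%:R :> R by rewrite sqr_sqrtr // ltW.
have spinE i : spins x i 0 = spin x i :> R by rewrite mxE.
have norm1 : euclidean_norm ((Num.sqrt n%:R)^-1 *: spins x) <= 1 :> R.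
  rewrite euclidean_normZ ?invr_ge0 ?(ltW s0) //.
  rewrite /euclidean_norm (eq_bigr (fun=> 1)) => [|i _]; last first.
    by rewrite spinE expr2 spin_sqr.
  by rewrite sumr_const card_ord mulVf ?gt_eqF ?lexx.
have := @spectral_normP B _ norm1.
rewrite -scalemxAr euclidean_normZ ?invr_ge0 ?(ltW s0) // ler_pdivrMl // => h.
have -> : \sum_i mulv B (spin x) i ^+ 2 = euclidean_norm (B *m spins x) ^+ 2.
  rewrite euclidean_norm_sqr; apply: eq_bigr => i _; rewrite mxE; congr (_ ^+ 2).
  by apply: eq_bigr => j _; rewrite spinE.
by rewrite -sn -exprMn lerXn2r ?nnegrE ?mulr_ge0 ?sqrtr_ge0 ?spectral_norm_ge0.
Qed.

Lemma neg_log_pl_lip (J J' : 'M[R]_n) x : (0 < n)%N ->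
  interaction_matrix J -> interaction_matrix J' ->
  neg_log_pl x J - neg_log_pl x J' <= 2 * n%:R * spectral_norm (J - J').
Proof.
move=> n0 hJ hJ'; rewrite !neg_log_plE // -sumrB.
have n0' : 0 < n%:R :> R by rewrite ltr0n.
apply: (@le_trans _ _ (\sum_i 2 * (1 * `|mulv (J - J') (spin x) i|))).
  apply: ler_sum => i _; apply: le_trans (softplus_lip _ _) _.
  have -> : mulv (J - J') (spin x) i = mulv J (spin x) i - mulv J' (spin x) i.
    by rewrite /mulv -sumrB; apply: eq_bigr => j _; rewrite !mxE mulrBl.
  by rewrite -opprD normrN -mulrBr !normrM norm_spin mulr1 mul1r ger0_norm.
rewrite -mulr_sumr -mulrA ler_wpM2l //.
have S0 : 0 <= \sum_i 1 * `|mulv (J - J') (spin x) i|.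
  by apply: sumr_ge0 => i _; rewrite mul1r.
rewrite -(@ler_pXn2r _ 2) ?nnegrE ?mulr_ge0 ?spectral_norm_ge0 ?(ltW n0') //.
apply: le_trans (@weighted_Cauchy_Schwarz _ _ (fun=> 1) _ n%:R n0' _ _) _ => //.
  by rewrite sumr_const card_ord.
have -> : (n%:R * spectral_norm (J - J')) ^+ 2 =
  n%:R * (n%:R * spectral_norm (J - J') ^+ 2) by ring.
rewrite ler_wpM2l ?(ltW n0') //.
apply: le_trans (mulv_spins_le _ x n0).
by apply: ler_sum => i _; rewrite mul1r real_normK ?num_real.
Qed.

End SpectralNorm.

(** * Covering the parametrized class *)

Section Covering.
Context {R : realType} {k : nat}.
Implicit Types (b : 'rV[R]_k) (N : nat).

(** The mesh is [2 / N]; there are [N.+1] cells per axis and not [N] because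
    coordinates equal to [1] get the index [N]. *)
Definition grid_cell N b : {ffun 'I_k -> 'I_N.+1} :=
  [ffun i => inord (Num.truncn ((b 0 i + 1) / 2 * N%:R))].

Lemma sup_norm_le b (c : R) : 0 <= c -> (forall i, `|b 0 i| <= c) -> `|b| <= c.
Proof.
move=> c0 hb; rewrite /Num.norm /= mx_normrE; apply: bigmax_le => // -[i j] _ /=.
by rewrite (ord1 i).
Qed.

Lemma grid_cell_dist N b b' : (0 < N)%N -> cube k b -> cube k b' ->
  grid_cell N b = grid_cell N b' -> `|b - b'| <= 2 / N%:R.
Proof.
move=> N0 hb hb' /ffunP eqc; have N0' : 0 < N%:R :> R by rewrite ltr0n.
apply: sup_norm_le => [|i]; first by rewrite divr_ge0.
have := eqc i; rewrite !ffunE => /(congr1 val) /=.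
have pos (y : R) : -1 <= y <= 1 -> 0 <= (y + 1) / 2 * N%:R.
  by move=> hy; rewrite mulr_ge0 //; lra.
have small (y : R) : -1 <= y <= 1 -> (Num.truncn ((y + 1) / 2 * N%:R) < N.+1)%N.
  move=> hy; rewrite ltnS -[leqRHS](@natrK R); apply: le_truncn.
  by rewrite -[leRHS]mul1r ler_wpM2r //; lra.
rewrite !inordK ?small // => eqt.
have /andP[l1 u1] := truncn_itv (pos _ (hb i)).
have /andP[l2 u2] := truncn_itv (pos _ (hb' i)).
rewrite -eqt in l2 u2; move: l1 u1 l2 u2; rewrite -[(Num.truncn _).+1%:R]natr1.
set t := (Num.truncn _)%:R; set y := b 0 i; set y' := b' 0 i => l1 u1 l2 u2.
rewrite !mxE -/y -/y' ler_pdivlMr // -(ger0_norm (ltW N0')) -normrM ler_norml.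
lra.
Qed.

End Covering.

Lemma ln2_ge (R : realType) : 1 / 2 <= ln 2 :> R.
Proof.
rewrite -[leLHS]expRK ler_ln ?posrE ?expR_gt0 //.
have := @expR_ge1Dx R (- (1 / 2)); rewrite expRN => h.
have p := @expR_gt0 R (1 / 2).
have := ler_wpM2l (ltW p) h; rewrite divff ?gt_eqF //; lra.
Qed.

Lemma ising_prob_union_bound {R : realType} (n : nat) (C : finType)
    (J : 'M[R]_n) (E : {set config n}) (P : pred C) (Q : C -> pred (config n)) :
  (forall x, x \in E -> exists c, P c && Q c x) ->
  ising_prob J E <= \sum_(c | P c) ising_prob J [set x | Q c x]%SET.
Proof.
move=> caught; rewrite /ising_prob.
under [leRHS]eq_bigr do rewrite big_mkcond.
rewrite exchange_big /= [leLHS]big_mkcond; apply: ler_sum => x _.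
have nn c : 0 <= (if x \in [set x | Q c x]%SET then ising_pmf J x else 0).
  by case: ifP => // _; apply: ltW; apply: ising_pmf_gt0.
case: ifP => [/caught[c /andP[Pc Qc]]|_]; last by apply: sumr_ge0.
by rewrite (bigD1 c) //= inE Qc lerDl; apply: sumr_ge0.
Qed.

Lemma diameter_le {R : realType} (n k : nat) (L : R) (h : 'rV[R]_k -> 'M[R]_n) b b' :
  0 < L -> cube k b -> cube k b' ->
  (forall b b', cube k b -> cube k b' ->
     spectral_norm (h b - h b') <= L * `|b - b'|) ->
  sqr_frobenius (h b - h b') <= n%:R * (2 * L) ^+ 2.
Proof.
move=> L0 hb hb' lip; apply: le_trans (sqr_frobenius_le_spectral _) _.
rewrite ler_wpM2l // lerXn2r ?nnegrE ?spectral_norm_ge0 ?mulr_ge0 ?(ltW L0) //.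
apply: le_trans (lip _ _ hb hb') _; rewrite mulrC ler_wpM2r ?(ltW L0) //.
apply: sup_norm_le => // i; rewrite !mxE ler_norml.
by have := hb i; have := hb' i; lra.
Qed.

Lemma sqr_frobenius_triangle {R : realType} (n : nat) (B B' : 'M[R]_n) :
  sqr_frobenius (B + B') <= 2 * sqr_frobenius B + 2 * sqr_frobenius B'.
Proof.
rewrite !sqr_frobeniusE !mulr_sumr -big_split; apply: ler_sum => i _ /=.
rewrite !mulr_sumr -big_split; apply: ler_sum => j _ /=; rewrite mxE.
by have := sqr_ge0 (B i j - B' i j); rewrite sqrrB sqrrD; lra.
Qed.

(** The net consists of points of the class itself, one for each grid cell that
    meets it, since the centre of a cell may violate the bound on the row
    sums. *)
Lemma param_class_net {R : realType} (n k N : nat) (L M : R)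
    (h : 'rV[R]_k -> 'M[R]_n) (J0 : 'M[R]_n) :
  0 < L -> (0 < N)%N -> param_class h M J0 ->
  (forall b b', cube k b -> cube k b' ->
     spectral_norm (h b - h b') <= L * `|b - b'|) ->
  exists rep : {ffun 'I_k -> 'I_N.+1} -> 'M[R]_n,
    (forall c, param_class h M (rep c)) /\
    (forall J, param_class h M J -> exists c,
       spectral_norm (J - rep c) <= L * (2 / N%:R) /\
       spectral_norm (rep c - J) <= L * (2 / N%:R)).
Proof.
move=> L0 N0 [[b0 cb0 hb0] M0] lip.
pose cls c := [set b : 'rV[R]_k |
  [/\ cube k b, infty_norm (h b) <= M & grid_cell N b = c]]%classic.
pose rep c := xget b0 (cls c).
exists (h \o rep); split=> [c|J [[b cb <-] Mb]].
  rewrite /= /rep; case: xgetP => [b _ [cb Mb _]|_]; split; rewrite ?hb0 //.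
    by exists b.
  by exists b0.
pose c := grid_cell N b; exists c.
have [cr _ gr] : cls c (rep c).
  by rewrite /rep; case: xgetP => [b' -> //|no]; case: (no b).
split; [apply: le_trans (lip _ _ cb cr) _|apply: le_trans (lip _ _ cr cb) _];
  by rewrite ler_wpM2l ?(ltW L0) // grid_cell_dist.
Qed.

Lemma sqr_frobenius_large {R : realType} (n : nat) (J J' B : 'M[R]_n) (t : R) :
  (0 < n)%N -> spectral_norm (J - J') <= 2 / n%:R ->
  t <= sqr_frobenius (J - B) -> t / 2 - 4 <= sqr_frobenius (J' - B).
Proof.
move=> n0 near ht; have n0' : 0 < n%:R :> R by rewrite ltr0n.
have := sqr_frobenius_triangle (J - J') (J' - B); rewrite addrA subrK.
have : sqr_frobenius (J - J') <= 4.
  apply: le_trans (sqr_frobenius_le_spectral _) _.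
  apply: (@le_trans _ _ (n%:R * (2 / n%:R) ^+ 2)).
    by rewrite ler_wpM2l ?(ltW n0') // lerXn2r ?nnegrE ?spectral_norm_ge0 ?divr_ge0
      ?(ltW n0').
  have -> : n%:R * (2 / n%:R) ^+ 2 = 4 / n%:R :> R by field; rewrite gt_eqF.
  by rewrite ler_pdivrMr // ler_peMr // ler1n.
lra.
Qed.

(** Of the factor [kap ^+ 20] the exponential rate consumes [kap ^+ 15], and
    [kap ^+ 5] outweighs the numerical constants. *)
Lemma rate_radius {R : realType} (kap S : R) : 16 <= kap -> 0 <= S ->
  16 * S <= rate kap * (kap^-1 ^+ 4 / 2) * (kap ^+ 20 * S).
Proof.
move=> k16 S0; have kc : kap * kap^-1 = 1 by rewrite divff // gt_eqF //; lra.
have -> : rate kap * (kap^-1 ^+ 4 / 2) * (kap ^+ 20 * S) = kap ^+ 5 / 3200 * S.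
  have -> : kap ^+ 5 / 3200 * S = kap ^+ 5 / 3200 * S * (kap * kap^-1) ^+ 15.
    by rewrite kc expr1n mulr1.
  by rewrite /rate; field; lra.
have k5 : 16 ^+ 5 <= kap ^+ 5 by rewrite lerXn2r ?nnegrE //; lra.
apply: ler_wpM2r => //; lra.
Qed.

(* The literal bound fails when k (ln n + ln L) + ln (1 / delta) is near zero
   or negative (possible only if n L < 2); the radicand is therefore floored at
   ln 2, which changes nothing as soon as n L >= 2. *)
Theorem corollary4 (R : realType) :
  exists A B : R, 0 < A /\ 0 < B /\
  forall (M delta : R) (n k : nat) (L : R) (h : 'rV[R]_k -> 'M[R]_n),
    0 < M -> 0 < delta < 1 -> (1 <= n)%N -> (1 <= k)%N -> 0 < L ->
    (forall b, cube k b -> interaction_matrix (h b)) ->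
    (forall b b', cube k b -> cube k b' ->
       spectral_norm (h b - h b') <= L * `|b - b'|) ->
  forall (Jstar : 'M[R]_n) (Jhat : config n -> 'M[R]_n),
    param_class h M Jstar ->
    (forall x, is_minimizer (neg_log_pl x) (param_class h M) (Jhat x)) ->
    1 - delta <=
    ising_prob Jstar
      [set x : config n |
        frobenius_norm (Jhat x - Jstar) <=
        A * expR (B * M) *
        Num.sqrt (Num.max (ln 2)
          (k%:R * (ln n%:R + ln L) + ln (1 / delta)))]%SET.
Proof.
have A0 : 0 < 16 ^+ 10 :> R by rewrite exprn_gt0 ?ltr0n.
exists (16 ^+ 10), 80; split; [exact: A0|split; first by rewrite ltr0n].
move=> M delta n k L h M0 /andP[d0 d1] n1 _ L0 hint lip Jstar Jhat hstar hhat.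
set S := Num.max _ _; set kap := conditioning M.
have -> : 16 ^+ 10 * expR (80 * M) = kap ^+ 10.
  rewrite /kap /conditioning exprMn -expRM_natl; congr (_ * expR _).
  by ring.
set rad := kap ^+ 10 * Num.sqrt S.
set E := [set x | _]%SET.
have k16 : 16 <= kap by have := conditioning_ge M; rewrite -/kap; lra.
have S2 : 1 / 2 <= S by rewrite /S le_max ln2_ge.
have rad0 : 0 <= rad by rewrite mulr_ge0 ?exprn_ge0 ?sqrtr_ge0 //; lra.
have radE : rad ^+ 2 = kap ^+ 20 * S.
  by rewrite /rad exprMn -exprM sqr_sqrtr //; lra.
have frobP (B : 'M[R]_n) : sqr_frobenius B <= rad ^+ 2 -> frobenius_norm B <= rad.
  move=> hB; rewrite -[leRHS]ger0_norm // -sqrtr_sqr ler_wsqrtr //.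
  by rewrite -sqr_frobeniusE.
have n0 : 0 < n%:R :> R by rewrite ltr0n.
have nL0 : 0 < n%:R * L by rewrite mulr_gt0.
have total : ising_prob Jstar E + ising_prob Jstar (~: E) = 1.
  rewrite -(sum_ising_pmf Jstar) /ising_prob [RHS](bigID (mem E)) /=; congr (_ + _).
  by apply: eq_bigl => x; rewrite inE.
suff : ising_prob Jstar (~: E) <= delta by lra.
have [small|large] := leP (n%:R * L) 2.
  (* the whole class then lies within Frobenius distance 4 of Jstar *)
  have -> : (~: E)%SET = finset.set0; last by rewrite /ising_prob big_set0 ltW.
  apply/setP => x; rewrite !inE; apply/negbTE; rewrite negbK; apply: frobP.
  have [[[b cb <-] _] _] := hhat x; have [[bs cbs <-] _] := hstar.
  apply: le_trans (diameter_le L0 cb cbs lip) _; rewrite radE.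
  have h1 : n%:R * (2 * L) ^+ 2 <= (2 * (n%:R * L)) ^+ 2.
    have -> : (2 * (n%:R * L)) ^+ 2 = n%:R * (n%:R * (2 * L) ^+ 2) by ring.
    by rewrite ler_wpM2l ?(ltW n0) // ler_peMl ?ler1n // sqr_ge0.
  have h2 : (2 * (n%:R * L)) ^+ 2 <= 16.
    have -> : 16 = 4 ^+ 2 :> R by ring.
    by rewrite lerXn2r ?nnegrE //; lra.
  have k20 : kap ^+ 2 <= kap ^+ 20 by rewrite ler_weXn2l //; lra.
  have k2 : 256 <= kap ^+ 2 by rewrite expr2; nra.
  apply: (le_trans h1); apply: (le_trans h2).
  apply: (@le_trans _ _ (32 * S)); first by lra.
  apply: ler_wpM2r; lra.
(* [N >= n * L] makes the mesh fine enough, and [N.+1 <= (n * L) ^+ 2], which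
   uses [n * L > 2], keeps the net small. *)
pose N := (Num.truncn (n%:R * L)).+1.
have N0 : 0 < N%:R :> R by rewrite ltr0n.
have Nlow : n%:R * L <= N%:R by rewrite ltW // truncnS_gt.
have Nup : N.+1%:R <= (n%:R * L) ^+ 2.
  have : (Num.truncn (n%:R * L))%:R <= n%:R * L by rewrite truncn_le ltW.
  rewrite /N -!natr1; set y := n%:R * L in large *; nra.
have mesh : L * (2 / N%:R) <= 2 / n%:R.
  by rewrite mulrCA ler_wpM2l // ler_pdivrMr // ler_pdivlMl.
have [rep [rep_class rep_near]] := param_class_net L0 (isT : (0 < N)%N) hstar lip.
have class_int J : param_class h M J -> interaction_matrix J.
  by case=> -[b cb <-] _; apply: hint.
pose T := rad ^+ 2 / 2 - 4.
pose far c := T <= sqr_frobenius (rep c - Jstar).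
pose close c x := neg_log_pl x (rep c) <= neg_log_pl x Jstar + 4.
(* Minimality of [Jhat x] passes to the nearest net point up to the slack [4],
   which is the Lipschitz constant [2 * n] times the mesh [2 / n]. *)
have caught x : x \in (~: E)%SET -> exists c, far c && close c x.
  rewrite !inE => /negP bad; have [hJhat opt] := hhat x.
  have [c [near near']] := rep_near _ hJhat; exists c; apply/andP; split.
    apply: (sqr_frobenius_large n1 (le_trans near mesh)).
    by rewrite leNgt; apply/negP => /ltW /frobP.
  have le2 := neg_log_pl_lip x n1 (class_int _ (rep_class c)) (class_int _ hJhat).
  have le3 : 2 * n%:R * spectral_norm (rep c - Jhat x) <= 4.
    apply: (@le_trans _ _ (2 * n%:R * (2 / n%:R))).
      by rewrite ler_wpM2l ?(le_trans near' mesh) // mulr_ge0 // ltW.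
    by have -> : 2 * n%:R * (2 / n%:R) = 4 :> R; [field; rewrite gt_eqF|].
  rewrite /close; apply: le_trans (lerD (opt _ hstar) (lexx 4)).
  by rewrite -lerBlDl; apply: le_trans le2 le3.
set theta := rate kap; set gam := kap^-1 ^+ 4 / 2.
have c0 : 0 < kap^-1 by rewrite invr_gt0; lra.
have c1 : kap^-1 <= 1 by rewrite invf_le1; lra.
have th0 : 0 <= theta by rewrite divr_ge0 ?ler0n // exprn_ge0 // ltW.
have gam0 : 0 <= gam by rewrite divr_ge0 // exprn_ge0 // ltW.
have each c : far c ->
    ising_prob Jstar [set x | close c x]%SET <= expR (theta * (4 - gam * T)).
  move=> fc.
  apply: le_trans (pl_separation 4 M0 (class_int _ hstar)
    (class_int _ (rep_class c)) hstar.2 (rep_class c).2) _.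
  by rewrite ler_expR ler_wpM2l // lerD2l lerN2 ler_wpM2l.
apply: (le_trans (ising_prob_union_bound Jstar caught)).
apply: (@le_trans _ _
    (\sum_(c : {ffun 'I_k -> 'I_N.+1}) expR (theta * (4 - gam * T)))).
  rewrite [leRHS](bigID far) /=; apply: ler_wpDr; last exact: ler_sum.
  by apply: sumr_ge0 => c _; apply: expR_ge0.
rewrite sumr_const card_ffun !card_ord.
pose l := ln n%:R + ln L.
have lE : n%:R * L = expR l by rewrite expRD !lnK ?posrE.
have card_le : (N.+1 ^ k)%:R <= expR (2 * (k%:R * l)).
  have -> : 2 * (k%:R * l) = (2 * k)%:R * l by rewrite natrM; ring.
  by rewrite expRM_natl -lE exprM natrX lerXn2r ?nnegrE ?ler0n ?sqr_ge0.
rewrite -[leRHS](@lnK R) ?posrE // -[leLHS]mulr_natl.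
apply: le_trans (ler_wpM2r (expR_ge0 _) card_le) _.
rewrite -expRD ler_expR.
have lnd : ln (1 / delta) = - ln delta by rewrite div1r lnV ?posrE.
have lnd0 : 0 <= ln (1 / delta) by rewrite lnd oppr_ge0 ln_le0 // ltW.
have hS : k%:R * l + ln (1 / delta) <= S by rewrite /S le_max lexx orbT.
have S0 : 0 <= S by lra.
have key : 16 * S <= theta * gam * rad ^+ 2 by rewrite radE; apply: rate_radius.
have th1 : theta <= 1 / 8.
  by have := exprn_ile1 11 (ltW c0) c1; rewrite /theta /rate; lra.
have gam1 : gam <= 1 by have := exprn_ile1 4 (ltW c0) c1; rewrite /gam; lra.
have tg : theta * gam <= 1 / 8 by rewrite -[leRHS]mulr1 ler_pM.
have -> : theta * (4 - gam * T) =
    4 * theta - theta * gam * rad ^+ 2 / 2 + 4 * (theta * gam).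
  by rewrite /T; field.
rewrite -[ln delta]opprK -lnd; lra.
Qed.
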